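(* Let $(F_s,F_e)$ be a pair of forms over a category $\mathbb{C}$. There is a noetherian form $G$ over $\mathbb{C}$ having an exact join decomposition $G=G_s\vee G_e$, with $G_s$ and $G_e$ isomorphic to $F_s$ and $F_e$, respectively, if and only if the pair $(F_s,F_e)$ is an orean factorization of $\mathbb{C}$ satisfying the following conditions (where $\alpha$ is the conormal operator $F_s\to F_e$ and $\beta$ is the normal operator $F_e\to F_s$): (i) $F_e$ satisfies (N1). Furthermore, for any morphism $f\colon X\to Y$, any $F_s$-cluster $A$ in $Y$ and any $F_e$-cluster $R$ in $Y$ such that $A\ast R=A$, $R\geq\alpha(A)$, $\mathrm{Im}^s f\geq A$ and $\mathrm{Im}^e f\geq R$, we have $(f\cdot^s(A\cdot^s f))\ast R=A$. (ii) The operator $\alpha\colon F_s\to F_e$ preserves binary meets. Furthermore, $A=A\ast\alpha(A)$ for every $F_s$-cluster $A$ and $R\geq\alpha(\beta(R))$ for every $F_e$-cluster $R$. Moreover, when $G$ exists, it is isomorphic to the subform of $F_s\times F_e$ consisting of those pairs $(A,R)$ for which $A\ast R=A$ and $\alpha(A)\leq R$.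
   Context: Forms. A form over a category $\mathbb{C}$ is a faithful functor $F\colon\mathbb{B}\to\mathbb{C}$ that is amnestic (an isomorphism of $\mathbb{B}$ sent to an identity morphism is an identity morphism). Objects of $\mathbb{B}$ sent to $X$ are called ($F$-)clusters in $X$. For $f\colon X\to Y$, a cluster $A$ in $X$ and a cluster $B$ in $Y$, $B\geq_f A$ means that some morphism $A\to B$ of $\mathbb{B}$ is sent to $f$; $\geq$ denotes $\geq_{1_X}$, a partial order on the clusters in $X$. $F$ is orean if: (O1) for each $X$ the clusters in $X$ form a bounded lattice ($\bot_X,\top_X,\vee,\wedge$); (O2) for $f\colon X\to Y$, $g\colon Y\to Z$, if $C\geq_{gf}A$ then there is a cluster $B$ in $Y$ with $C\geq_g B$ and $B\geq_f A$; (O3) for $f\colon X\to Y$ and a cluster $S$ in $X$ there is a least cluster $f\cdot S$ in $Y$ among those $T$ with $T\geq_f S$ (direct image), and for a cluster $T$ in $Y$ there is a largest cluster $T\cdot f$ in $X$ among those $S$ with $T\geq_f S$ (inverse image). For $f\colon X\to Y$ put $\mathrm{Im} f=f\cdot\top_X$, $\mathrm{Ker} f=\bot_Y\cdot f$. A cluster is conormal (normal) if it is the image (kernel) of some morphism. An orean form is conormal (normal) if all its clusters are. Superscripts $F$, $s$, $e$ indicate the form ($F$, $F_s$, $F_e$) in which a construction is taken. Operators. For forms $F,G$ over $\mathbb{C}$, an operator $\tau\colon F\to G$ is a functor between the domains with $G\circ\tau=F$; equivalently, a map of clusters over each object such that $B\geq_f A$ implies $\tau B\geq_f\tau A$. An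 isomorphism of forms is an invertible operator. A collection of $F$-clusters, with the relations $\geq_f$ restricted, is a subform of $F$. For an idempotent operator $\tau\colon F\to F$, $F_\tau$ is the subform of clusters $S$ with $\tau S=S$. An operator $\tau\colon F\to G$ of orean forms is conormal if $\tau(\mathrm{Im}^F f)=\mathrm{Im}^G f$ for all $f$, normal if $\tau(\mathrm{Ker}^F f)=\mathrm{Ker}^G f$ for all $f$, binormal if both. The product $F\times G$ has as clusters in $X$ the pairs $(A,R)$ of an $F$-cluster and a $G$-cluster in $X$, with $(B,S)\geq_f(A,R)$ iff $B\geq_f A$ and $S\geq_f R$. Noetherian forms. For an orean form, an embedding of a conormal cluster $S$ in $X$ is a morphism $m\colon W\to X$ with $\mathrm{Im}\, m=S$ such that every $m'\colon W'\to X$ with $\mathrm{Im}\, m'\leq S$ factors uniquely as $m'=mg$; it is denoted $\iota_S$. A quotient of a normal cluster $S$ in $X$ is a morphism $q\colon X\to Y$ with $\mathrm{Ker}\, q=S$ such that every $q'\colon X\to Y'$ with $\mathrm{Ker}\, q'\geq S$ factors uniquely as $q'=hq$; it is denoted $\pi_S$. These are unique up to isomorphism. An orean form is noetherian if: (N1) for every $f\colon X\to Y$, $(f\cdot S)\cdot f=S\vee\mathrm{Ker} f$ for all clusters $S$ in $X$, and $f\cdot(T\cdot f)=T\wedge\mathrm{Im} f$ for all clusters $T$ in $Y$; (N2) every morphism $f$ factors as $f=me$ with $m$ an embedding of $\mathrm{Im} f$ and $e$ a quotient of $\mathrm{Ker} f$; (N3) the join of two normal clusters is normal and the meet of two conormal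 clusters is conormal. Exact join decomposition. A join decomposition $F=F_s\vee F_e$ of an orean form $F$ is a pair $(\kappa_s,\kappa_e)$ of idempotent operators $F\to F$ such that $F_s=F_{\kappa_s}$ is a conormal orean form, $F_e=F_{\kappa_e}$ is a normal orean form, and $S=\kappa_s S\vee\kappa_e S$ for every cluster $S$. Let $\tau_s\colon F\to F_s$, $\tau_e\colon F\to F_e$ be the restrictions of $\kappa_s,\kappa_e$. The decomposition is exact if $\tau_s,\tau_e$ are binormal, there exist a conormal operator $F_s\to F_e$ and a normal operator $F_e\to F_s$, the subform inclusion $F_s\to F$ is conormal and the subform inclusion $F_e\to F$ is normal. Orean factorizations. An orean factorization of $\mathbb{C}$ is an ordered pair $(F_s,F_e)$ where $F_s$ is a conormal orean form and $F_e$ a normal orean form over $\mathbb{C}$ such that every morphism $f$ factors as $f=me$ with $m$ an $F_s$-embedding of $\mathrm{Im}^s f$ and $e$ an $F_e$-quotient of $\mathrm{Ker}^e f$. For an orean factorization there are a unique conormal operator $\alpha\colon F_s\to F_e$, given by $\alpha(A)=\mathrm{Im}^e\iota^s_A$, and a unique normal operator $\beta\colon F_e\to F_s$, given by $\beta(R)=\mathrm{Ker}^s\pi^e_R$. For an $F_s$-cluster $A$ and an $F_e$-cluster $R$ in the same object, the Wyler join is $A\ast R=(\pi^e_R\cdot^s A)\cdot^s\pi^e_R$. *)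

(* Defs.v *)
From Stdlib Require Import ssreflect ProofIrrelevance IndefiniteDescription.

Set Implicit Arguments.
Unset Strict Implicit.
Unset Printing Implicit Defensive.

Declare Scope form_scope.
Delimit Scope form_scope with form.
Open Scope form_scope.

Record category := Category {
  ob :> Type;
  hom : ob -> ob -> Type;
  idm : forall X, hom X X;
  comp : forall X Y Z, hom Y Z -> hom X Y -> hom X Z;
  comp1m : forall X Y (f : hom X Y), comp (idm Y) f = f;
  compm1 : forall X Y (f : hom X Y), comp f (idm X) = f;
  compA : forall W X Y Z (h : hom Y Z) (g : hom X Y) (f : hom W X),
    comp h (comp g f) = comp (comp h g) f
}.
Arguments hom {_} _ _.
Arguments idm {_} _.
Arguments comp {_ _ _ _} _ _.

Reserved Notation "g \o f" (at level 50, left associativity).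
Notation "g \o f" := (comp g f) : form_scope.

Definition is_iso (C : category) (X Y : C) (f : hom X Y) : Prop :=
  exists g : hom Y X, g \o f = idm X /\ f \o g = idm Y.

(* [f] is an identity morphism; this includes the equality of its domain and
   codomain. *)
Inductive is_identity (C : category) (X : C) : forall Y : C, hom X Y -> Prop :=
  IsIdentity : is_identity (idm X).

Record functor (B C : category) := Functor {
  fobj :> B -> C;
  fmap : forall X Y : B, hom X Y -> hom (fobj X) (fobj Y);
  fmap1 : forall X : B, fmap (idm X) = idm (fobj X);
  fmapM : forall (X Y Z : B) (g : hom Y Z) (f : hom X Y),
    fmap (g \o f) = fmap g \o fmap f
}.
Arguments fmap {B C} _ {X Y} _.

Record form (C : category) := Form {
  dom : category;
  fn :> functor dom C;
  form_faithful : forall (A B : dom) (h k : hom A B),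
    fmap fn h = fmap fn k -> h = k;
  form_amnestic : forall (A B : dom) (h : hom A B),
    is_iso h -> is_identity (fmap fn h) -> is_identity h
}.

Definition cluster (C : category) (F : form C) (X : C) : Type :=
  {A : dom F | F A = X}.

Definition cluster_of (C : category) (F : form C) (A : dom F) : cluster F (F A) :=
  exist _ A eq_refl.

Definition hom_cast (C : category) (X X' Y Y' : C) (eX : X = X') (eY : Y = Y')
    (f : hom X Y) : hom X' Y' :=
  match eX in _ = X', eY in _ = Y' return hom X' Y' with
  | eq_refl, eq_refl => f
  end.

Section HomCast.
Variable C : category.

Lemma hom_cast1 (X X' : C) (e : X = X') : hom_cast e e (idm X) = idm X'.
Proof. by case: _ / e. Qed.

Lemma hom_castM (X X' Y Y' Z Z' : C) (eX : X = X') (eY : Y = Y') (eZ : Z = Z')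
    (g : hom Y Z) (f : hom X Y) :
  hom_cast eX eZ (g \o f) = hom_cast eY eZ g \o hom_cast eX eY f.
Proof. by case: _ / eX; case: _ / eY; case: _ / eZ. Qed.

Lemma hom_cast_inj (X X' Y Y' : C) (eX : X = X') (eY : Y = Y') (f g : hom X Y) :
  hom_cast eX eY f = hom_cast eX eY g -> f = g.
Proof. by case: _ / eX; case: _ / eY. Qed.

Lemma hom_cast_identity (X Y Z : C) (eX : X = Z) (eY : Y = Z) (f : hom X Y) :
  hom_cast eX eY f = idm Z -> is_identity f.
Proof. by subst X Y => /= ->; exact: IsIdentity. Qed.

End HomCast.

(* [geq f B A]: some morphism [A -> B] of the domain of [F] is sent to [f]. *)
Definition geq (C : category) (F : form C) (X Y : C) (f : hom X Y)
    (B : cluster F Y) (A : cluster F X) : Prop :=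
  exists h : hom (proj1_sig A) (proj1_sig B),
    hom_cast (proj2_sig A) (proj2_sig B) (fmap F h) = f.

Notation "B >=[ f ] A" := (geq f B A)
  (at level 70, f at level 200, no associativity,
   format "B  >=[ f ]  A") : form_scope.
Notation "B >= A" := (geq (idm _) B A) : form_scope.

Section GeqTheory.
Variables (C : category) (F : form C).

Lemma geq_refl (X : C) (A : cluster F X) : A >= A.
Proof.
case: A => a e; subst X; exists (idm a) => /=; exact: fmap1.
Qed.

Lemma geq_trans (X Y Z : C) (f : hom X Y) (g : hom Y Z)
    (A : cluster F X) (B : cluster F Y) (D : cluster F Z) :
  D >=[g] B -> B >=[f] A -> D >=[g \o f] A.
Proof.
case: A => a ea; case: B => b eb; case: D => d ed; subst X Y Z.
case=> k /= <-; case=> h /= <-; exists (k \o h) => /=; exact: fmapM.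
Qed.

Lemma geq_transl (X Y : C) (f : hom X Y) (A : cluster F X) (B D : cluster F Y) :
  D >= B -> B >=[f] A -> D >=[f] A.
Proof. by move=> DB BA; have := geq_trans DB BA; rewrite comp1m. Qed.

Lemma geq_transr (X Y : C) (f : hom X Y) (A B : cluster F X) (D : cluster F Y) :
  D >=[f] B -> B >= A -> D >=[f] A.
Proof. by move=> DB BA; have := geq_trans DB BA; rewrite compm1. Qed.

Lemma geq_antisym (X : C) (A B : cluster F X) : A >= B -> B >= A -> A = B.
Proof.
case: A => a ea; case: B => b eb [k Fk] [h Fh]; simpl in k, h, Fk, Fh.
have iso_h : is_iso h.
  exists k; split; apply: form_faithful; rewrite fmap1 fmapM.
    apply: (hom_cast_inj (eX := ea) (eY := ea)).
    by rewrite (hom_castM _ eb) Fk Fh hom_cast1 comp1m.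
  apply: (hom_cast_inj (eX := eb) (eY := eb)).
  by rewrite (hom_castM _ ea) Fk Fh hom_cast1 comp1m.
have idFh : is_identity (fmap F h).
  by apply: (hom_cast_identity (eX := ea) (eY := eb)); rewrite Fh.
have idh := form_amnestic iso_h idFh.
case: _ / idh eb {k Fh Fk iso_h idFh} => eb.
by rewrite (proof_irrelevance _ eb ea).
Qed.

End GeqTheory.

(* Since [>=] is a partial order, the operations below are determined by [F];
   carrying them as data is the same as requiring the bounds, direct images
   and inverse images to exist. *)
Record orean (C : category) (F : form C) := Orean {
  bot : forall X, cluster F X;
  top : forall X, cluster F X;
  join : forall X, cluster F X -> cluster F X -> cluster F X;
  meet : forall X, cluster F X -> cluster F X -> cluster F X;
  bot_least : forall X (S : cluster F X), S >= bot X;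
  top_largest : forall X (S : cluster F X), top X >= S;
  join_ubl : forall X (S T : cluster F X), join S T >= S;
  join_ubr : forall X (S T : cluster F X), join S T >= T;
  join_lub : forall X (S T U : cluster F X), U >= S -> U >= T -> U >= join S T;
  meet_lbl : forall X (S T : cluster F X), S >= meet S T;
  meet_lbr : forall X (S T : cluster F X), T >= meet S T;
  meet_glb : forall X (S T U : cluster F X), S >= U -> T >= U -> meet S T >= U;
  geq_split : forall X Y Z (f : hom X Y) (g : hom Y Z)
      (A : cluster F X) (D : cluster F Z),
    D >=[g \o f] A -> exists B : cluster F Y, D >=[g] B /\ B >=[f] A;
  dimg : forall X Y, hom X Y -> cluster F X -> cluster F Y;
  dimg_geq : forall X Y (f : hom X Y) (S : cluster F X), dimg f S >=[f] S;
  dimg_least : forall X Y (f : hom X Y) (S : cluster F X) (T : cluster F Y),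
    T >=[f] S -> T >= dimg f S;
  iimg : forall X Y, hom X Y -> cluster F Y -> cluster F X;
  iimg_geq : forall X Y (f : hom X Y) (T : cluster F Y), T >=[f] iimg f T;
  iimg_largest : forall X Y (f : hom X Y) (S : cluster F X) (T : cluster F Y),
    T >=[f] S -> iimg f T >= S
}.

Section OreanNotions.
Variables (C : category) (F : form C) (o : orean F).

Definition Im (X Y : C) (f : hom X Y) : cluster F Y := dimg o f (top o X).
Definition Ker (X Y : C) (f : hom X Y) : cluster F X := iimg o f (bot o Y).

Definition conormal_cluster (X : C) (S : cluster F X) : Prop :=
  exists (W : C) (f : hom W X), S = Im f.
Definition normal_cluster (X : C) (S : cluster F X) : Prop :=
  exists (Y : C) (f : hom X Y), S = Ker f.

Definition conormal_form : Prop :=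
  forall (X : C) (S : cluster F X), conormal_cluster S.
Definition normal_form : Prop :=
  forall (X : C) (S : cluster F X), normal_cluster S.

Definition is_embedding (X : C) (S : cluster F X) (W : C) (m : hom W X) : Prop :=
  Im m = S /\
  forall (W' : C) (m' : hom W' X), S >= Im m' ->
    exists! g : hom W' W, m' = m \o g.

Definition is_quotient (X : C) (S : cluster F X) (Y : C) (q : hom X Y) : Prop :=
  Ker q = S /\
  forall (Y' : C) (q' : hom X Y'), Ker q' >= S ->
    exists! h : hom Y Y', q' = h \o q.

Definition N1 : Prop :=
  forall (X Y : C) (f : hom X Y),
    (forall S : cluster F X, iimg o f (dimg o f S) = join o S (Ker f)) /\
    (forall T : cluster F Y, dimg o f (iimg o f T) = meet o T (Im f)).

Definition N2 : Prop :=
  forall (X Y : C) (f : hom X Y), exists (Z : C) (e : hom X Z) (m : hom Z Y),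
    f = m \o e /\ is_embedding (Im f) m /\ is_quotient (Ker f) e.

Definition N3 : Prop :=
  forall (X : C) (S T : cluster F X),
    (normal_cluster S -> normal_cluster T -> normal_cluster (join o S T)) /\
    (conormal_cluster S -> conormal_cluster T -> conormal_cluster (meet o S T)).

Definition noetherian : Prop := N1 /\ N2 /\ N3.

Lemma top_geq (X Y : C) (f : hom X Y) : top o Y >=[f] top o X.
Proof.
exact: geq_transl (top_largest o _) (dimg_geq o f (top o X)).
Qed.

Lemma bot_geq (X Y : C) (f : hom X Y) : bot o Y >=[f] bot o X.
Proof.
exact: geq_transr (iimg_geq o f (bot o Y)) (bot_least o _).
Qed.

Lemma Im_comp (X Y Z : C) (f : hom X Y) (g : hom Y Z) :
  Im (g \o f) = dimg o g (Im f).
Proof.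
apply: geq_antisym.
  have /(geq_split o) [D [gD Df]] := dimg_geq o (g \o f) (top o X).
  by apply: dimg_least; apply: geq_transr gD _; apply: dimg_least.
by apply: dimg_least; apply: geq_trans (dimg_geq o _ _) (dimg_geq o _ _).
Qed.

Lemma Ker_comp (X Y Z : C) (f : hom X Y) (g : hom Y Z) :
  Ker (g \o f) = iimg o f (Ker g).
Proof.
apply: geq_antisym; last first.
  have /(geq_split o) [D [gD Df]] := iimg_geq o (g \o f) (bot o Z).
  by apply: iimg_largest; apply: geq_transl Df; apply: iimg_largest.
by apply: iimg_largest; apply: geq_trans (iimg_geq o _ _) (iimg_geq o _ _).
Qed.

Lemma embedding_mono (X W V : C) (S : cluster F X) (m : hom W X) (g h : hom V W) :
  is_embedding S m -> m \o g = m \o h -> g = h.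
Proof.
move=> [eS um] e; have le_g : S >= Im (m \o g).
  rewrite -eS; apply: dimg_least; apply: geq_trans (dimg_geq o _ _) _.
  exact: top_geq.
have [k [_ uk]] := um _ _ le_g.
by rewrite -(uk g) // -(uk h).
Qed.

Lemma quotient_epi (X Y V : C) (S : cluster F X) (q : hom X Y) (g h : hom Y V) :
  is_quotient S q -> g \o q = h \o q -> g = h.
Proof.
move=> [eS uq] e; have le_g : Ker (g \o q) >= S.
  rewrite -eS; apply: iimg_largest; apply: geq_trans (iimg_geq o _ _).
  exact: bot_geq.
have [k [_ uk]] := uq _ _ le_g.
by rewrite -(uk g) // -(uk h).
Qed.

End OreanNotions.

(* An operator is a functor [t] between the domains with [G t = F].  As forms are
   faithful, it amounts to the map that it induces on clusters. *)
Record operator (C : category) (F G : form C) := Operator {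
  op : forall X : C, cluster F X -> cluster G X;
  op_geq : forall (X Y : C) (f : hom X Y) (A : cluster F X) (B : cluster F Y),
    B >=[f] A -> op B >=[f] op A
}.
Arguments op {C F G} _ {X} _.

Definition form_iso (C : category) (F G : form C) : Prop :=
  exists (s : operator F G) (t : operator G F),
    (forall (X : C) (A : cluster F X), op t (op s A) = A) /\
    (forall (X : C) (B : cluster G X), op s (op t B) = B).

Definition op_idempotent (C : category) (F : form C) (t : operator F F) : Prop :=
  forall (X : C) (S : cluster F X), op t (op t S) = op t S.

Section BinormalOperators.
Variables (C : category) (F G : form C) (oF : orean F) (oG : orean G).
Variable t : operator F G.

Definition op_conormal : Prop :=
  forall (X Y : C) (f : hom X Y), op t (Im oF f) = Im oG f.
Definition op_normal : Prop :=
  forall (X Y : C) (f : hom X Y), op t (Ker oF f) = Ker oG f.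
Definition op_binormal : Prop := op_conormal /\ op_normal.

End BinormalOperators.

(* An object [A] of the domain of [F] is the same thing as a cluster in [F A],
   so a collection of clusters is a predicate on objects of the domain, and the
   subform is the restriction of [F] to the full subcategory it spans. *)
Section Subform.
Variables (C : category) (F : form C) (P : dom F -> Prop).

Definition sub_dom : category.
Proof.
refine (@Category {A : dom F | P A}
  (fun A B => hom (proj1_sig A) (proj1_sig B))
  (fun A => idm (proj1_sig A)) (fun _ _ _ g f => g \o f) _ _ _).
- by move=> X Y f; apply: comp1m.
- by move=> X Y f; apply: compm1.
- by move=> W X Y Z h g f; apply: compA.
Defined.

Definition sub_functor : functor sub_dom C.
Proof.
refine (@Functor sub_dom C (fun A => F (proj1_sig A))
  (fun _ _ h => fmap F h) _ _).
- by move=> X; apply: fmap1.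
- by move=> X Y Z g f; apply: fmapM.
Defined.

Definition subform : form C.
Proof.
refine (@Form C sub_dom sub_functor _ _).
- by move=> A B h k; apply: form_faithful.
- move=> [A pA] [B pB] /= h iso_h idFh.
  have idh : is_identity h by apply: (form_amnestic (f := F)).
  case: idh pB {iso_h idFh} => pB; rewrite (proof_irrelevance _ pB pA).
  exact: (@IsIdentity sub_dom (exist _ A pA)).
Defined.

Definition sub_cluster (X : C) (A : cluster F X) (pA : P (proj1_sig A)) :
    cluster subform X :=
  exist (fun B : dom subform => subform B = X)
    (exist _ (proj1_sig A) pA) (proj2_sig A).

Definition sub_incl_cluster (X : C) (A : cluster subform X) : cluster F X :=
  exist (fun B : dom F => F B = X) (proj1_sig (proj1_sig A)) (proj2_sig A).

Definition sub_incl : operator subform F.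
Proof.
refine (@Operator C subform F sub_incl_cluster _).
by move=> X Y f A B [h hf]; exists h.
Defined.

End Subform.

Section FixedForm.
Variables (C : category) (F : form C) (t : operator F F).

Definition fixed (A : dom F) : Prop := op t (cluster_of A) = cluster_of A.

Definition fixed_form : form C := subform fixed.

Lemma fixedP (X : C) (S : cluster F X) : fixed (proj1_sig S) <-> op t S = S.
Proof. by case: S => a e; subst X. Qed.

Hypothesis t_idem : op_idempotent t.

Definition fixed_restr : operator F fixed_form.
Proof.
refine (@Operator C F fixed_form
  (fun X S => sub_cluster (proj2 (fixedP (op t S)) (t_idem S))) _).
by move=> X Y f A B /(op_geq t) [h hf]; exists h.
Defined.

End FixedForm.

Section Product.
Variables (C : category) (F G : form C).

(* The total category of the family of pairs of clusters, so that the fibre over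
   [X] consists of the pairs of clusters in [X]. *)
Record prod_ob := ProdOb {
  prod_base : C;
  prod_fst : cluster F prod_base;
  prod_snd : cluster G prod_base
}.

Definition prod_hom (P Q : prod_ob) : Type :=
  {f : hom (prod_base P) (prod_base Q) |
    prod_fst Q >=[f] prod_fst P /\ prod_snd Q >=[f] prod_snd P}.

Lemma prod_hom_eq (P Q : prod_ob) (f g : prod_hom P Q) :
  proj1_sig f = proj1_sig g -> f = g.
Proof.
case: f => f pf; case: g => g pg /= e; subst g.
by rewrite (proof_irrelevance _ pf pg).
Qed.

Definition prod_id (P : prod_ob) : prod_hom P P :=
  exist _ (idm (prod_base P))
    (conj (geq_refl (prod_fst P)) (geq_refl (prod_snd P))).

Definition prod_comp (P Q R : prod_ob) (g : prod_hom Q R) (f : prod_hom P Q) :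
    prod_hom P R :=
  exist _ (proj1_sig g \o proj1_sig f)
    (conj (geq_trans (proj1 (proj2_sig g)) (proj1 (proj2_sig f)))
          (geq_trans (proj2 (proj2_sig g)) (proj2 (proj2_sig f)))).

Definition prod_dom : category.
Proof.
refine (@Category prod_ob prod_hom prod_id prod_comp _ _ _).
- by move=> P Q f; apply: prod_hom_eq; apply: comp1m.
- by move=> P Q f; apply: prod_hom_eq; apply: compm1.
- by move=> P Q R S h g f; apply: prod_hom_eq; apply: compA.
Defined.

Definition prod_functor : functor prod_dom C :=
  @Functor prod_dom C prod_base (fun _ _ f => proj1_sig f)
    (fun _ => eq_refl) (fun _ _ _ _ _ => eq_refl).

Definition prod_form : form C.
Proof.
refine (@Form C prod_dom prod_functor _ _).
- by move=> P Q h k; apply: prod_hom_eq.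
- move=> [X A R] [Y B S] [f pf] [[g pg] [/(f_equal (@proj1_sig _ _)) gf _]] idf.
  simpl in f, pf, g, pg, gf, idf; destruct idf.
  rewrite compm1 in gf; subst g.
  have eB : B = A by exact: geq_antisym (proj1 pf) (proj1 pg).
  have eS : S = R by exact: geq_antisym (proj2 pf) (proj2 pg).
  subst B S; set h := exist _ _ _.
  have -> : h = prod_id (ProdOb A R) by apply: prod_hom_eq.
  exact: (@IsIdentity prod_dom).
Defined.

End Product.

Record join_decomposition (C : category) (F : form C) (o : orean F) :=
  JoinDecomposition {
  jd_s : operator F F;
  jd_e : operator F F;
  jd_s_idem : op_idempotent jd_s;
  jd_e_idem : op_idempotent jd_e;
  jd_s_orean : orean (fixed_form jd_s);
  jd_s_conormal : conormal_form jd_s_orean;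
  jd_e_orean : orean (fixed_form jd_e);
  jd_e_normal : normal_form jd_e_orean;
  jd_join : forall (X : C) (S : cluster F X), S = join o (op jd_s S) (op jd_e S)
}.

Section Exactness.
Variables (C : category) (F : form C) (o : orean F) (d : join_decomposition o).

Definition jd_form_s : form C := fixed_form (jd_s d).
Definition jd_form_e : form C := fixed_form (jd_e d).

Record jd_exact : Prop := JdExact {
  exact_restr_s :
    op_binormal o (jd_s_orean d) (fixed_restr (jd_s_idem d));
  exact_restr_e :
    op_binormal o (jd_e_orean d) (fixed_restr (jd_e_idem d));
  exact_se : exists a : operator jd_form_s jd_form_e,
    op_conormal (jd_s_orean d) (jd_e_orean d) a;
  exact_es : exists b : operator jd_form_e jd_form_s,
    op_normal (jd_e_orean d) (jd_s_orean d) b;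
  exact_incl_s : op_conormal (jd_s_orean d) o (sub_incl (fixed (jd_s d)));
  exact_incl_e : op_normal (jd_e_orean d) o (sub_incl (fixed (jd_e d)))
}.

End Exactness.

Record orean_factorization (C : category) (Fs Fe : form C) :=
  OreanFactorization {
  of_s : orean Fs;
  of_e : orean Fe;
  of_s_conormal : conormal_form of_s;
  of_e_normal : normal_form of_e;
  of_factor : forall (X Y : C) (f : hom X Y),
    exists (Z : C) (e : hom X Z) (m : hom Z Y),
      f = m \o e /\ is_embedding of_s (Im of_s f) m /\
      is_quotient of_e (Ker of_e f) e
}.

Section OreanFactorization.
Variables (C : category) (Fs Fe : form C) (w : orean_factorization Fs Fe).
Let os : orean Fs := of_s w.
Let oe : orean Fe := of_e w.

Lemma embedding_exists (X : C) (A : cluster Fs X) :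
  exists p : {W : C & hom W X}, is_embedding os A (projT2 p).
Proof.
have [W [f ->]] := of_s_conormal w A.
have [Z [e [m [_ [m_emb _]]]]] := of_factor w f.
by exists (existT _ Z m).
Qed.

Lemma quotient_exists (X : C) (R : cluster Fe X) :
  exists p : {Y : C & hom X Y}, is_quotient oe R (projT2 p).
Proof.
have [Y [f ->]] := of_e_normal w R.
have [Z [e [m [_ [_ e_quo]]]]] := of_factor w f.
by exists (existT _ Z e).
Qed.

(* Embeddings and quotients are unique up to isomorphism, so [alpha], [beta] and
   [wyler_join] do not depend on the choice made here. *)
Definition emb_dom (X : C) (A : cluster Fs X) : C :=
  projT1 (proj1_sig (constructive_indefinite_description _ (embedding_exists A))).
Definition emb (X : C) (A : cluster Fs X) : hom (emb_dom A) X :=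
  projT2 (proj1_sig (constructive_indefinite_description _ (embedding_exists A))).

Lemma embP (X : C) (A : cluster Fs X) : is_embedding os A (emb A).
Proof. by rewrite /emb /emb_dom; case: constructive_indefinite_description. Qed.

Definition quo_cod (X : C) (R : cluster Fe X) : C :=
  projT1 (proj1_sig (constructive_indefinite_description _ (quotient_exists R))).
Definition quo (X : C) (R : cluster Fe X) : hom X (quo_cod R) :=
  projT2 (proj1_sig (constructive_indefinite_description _ (quotient_exists R))).

Lemma quoP (X : C) (R : cluster Fe X) : is_quotient oe R (quo R).
Proof. by rewrite /quo /quo_cod; case: constructive_indefinite_description. Qed.


Lemma alpha_geq (X Y : C) (f : hom X Y) (A : cluster Fs X) (B : cluster Fs Y) :
  B >=[f] A -> Im oe (emb B) >=[f] Im oe (emb A).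
Proof.
move=> BA; have [eA _] := embP A; have [_ uB] := embP B.
have BfA : B >= Im os (f \o emb A).
  apply: dimg_least; apply: geq_trans BA _; rewrite -[X in X >=[_] _]eA.
  exact: dimg_geq.
have [g [eg _]] := uB _ _ BfA.
have : Im oe (emb B) >=[f \o emb A] top oe _.
  by rewrite eg; apply: geq_trans (dimg_geq oe _ _) (top_geq oe g).
case/(geq_split oe)=> D [BD DA].
by apply: geq_transr BD _; apply: dimg_least.
Qed.

(* [alpha] is the unique conormal operator [Fs -> Fe], and [beta] below the
   unique normal operator [Fe -> Fs]: see [alpha_conormal], [alpha_unique],
   [beta_normal] and [beta_unique]. *)
Definition alpha : operator Fs Fe :=
  @Operator C Fs Fe (fun X A => Im oe (emb A)) alpha_geq.

Lemma beta_geq (X Y : C) (f : hom X Y) (R : cluster Fe X) (S : cluster Fe Y) :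
  S >=[f] R -> Ker os (quo S) >=[f] Ker os (quo R).
Proof.
move=> SR; have [_ uR] := quoP R; have [eS _] := quoP S.
have SfR : Ker oe (quo S \o f) >= R.
  apply: iimg_largest; apply: geq_trans SR; rewrite -[X in _ >=[_] X]eS.
  exact: iimg_geq.
have [h [eh _]] := uR _ _ SfR.
have : bot os _ >=[quo S \o f] Ker os (quo R).
  by rewrite eh; apply: geq_trans (bot_geq os h) (iimg_geq os _ _).
case/(geq_split os)=> D [SD DR].
by apply: geq_transl DR; apply: iimg_largest.
Qed.

Definition beta : operator Fe Fs :=
  @Operator C Fe Fs (fun X R => Ker os (quo R)) beta_geq.

Definition wyler_join (X : C) (A : cluster Fs X) (R : cluster Fe X) :
    cluster Fs X :=
  iimg os (quo R) (dimg os (quo R) A).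

Lemma quotient_Im_s (X Y : C) (R : cluster Fe X) (e : hom X Y) :
  is_quotient oe R e -> Im os e = top os Y.
Proof.
move=> qe; have [eR ue] := qe.
have [Z [e' [m [em [[emb_m _] [eK _]]]]]] := of_factor w e.
have le_e' : Ker oe e' >= R by rewrite eK eR; exact: geq_refl.
have [i [ei _]] := ue _ _ le_e'.
have mi : m \o i = idm Y.
  by apply: (quotient_epi qe); rewrite comp1m -compA -ei -em.
apply: geq_antisym; last exact: top_largest.
rewrite -emb_m -mi; exact: geq_trans (dimg_geq os m (top os Z)) (top_geq os i).
Qed.

Lemma embedding_Ker_e (X Y : C) (A : cluster Fs Y) (m : hom X Y) :
  is_embedding os A m -> Ker oe m = bot oe X.
Proof.
move=> qm; have [eA um] := qm.
have [Z [e [m' [em [[eI _] [quo_e _]]]]]] := of_factor w m.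
have le_m' : A >= Im os m' by rewrite eI eA; exact: geq_refl.
have [i [ei _]] := um _ _ le_m'.
have ie : i \o e = idm X.
  by apply: (embedding_mono qm); rewrite compm1 compA -ei -em.
apply: geq_antisym; first exact: bot_least.
rewrite -quo_e -ie; exact: geq_trans (bot_geq oe i) (iimg_geq oe e (bot oe Z)).
Qed.

Lemma embedding_top_iso (X Y : C) (m : hom X Y) :
  is_embedding os (top os Y) m -> is_iso m.
Proof.
move=> qm; have [_ um] := qm.
have [i [ei _]] := um _ (idm Y) (top_largest os _).
exists i; split=> //; apply: (embedding_mono qm).
by rewrite compA -ei comp1m compm1.
Qed.

Lemma quotient_bot_iso (X Y : C) (q : hom X Y) :
  is_quotient oe (bot oe X) q -> is_iso q.
Proof.
move=> qq; have [_ uq] := qq.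
have [i [ei _]] := uq _ (idm X) (bot_least oe _).
exists i; split=> //; apply: (quotient_epi qq).
by rewrite -compA -ei comp1m compm1.
Qed.

Lemma quotient_top (X Q : C) (q : hom X Q) :
  is_quotient oe (top oe X) q -> bot oe Q >= top oe Q.
Proof.
move=> qq; have [eq_ uq] := qq.
have [[Q' n] /= qn] := quotient_exists (top oe Q); have [en _] := qn.
have [Z [e [m [enq [emb_m quo_e]]]]] := of_factor w (n \o q).
have Knq : Ker oe (n \o q) = top oe X.
  apply: geq_antisym; last exact: top_largest.
  rewrite -eq_; apply: iimg_largest.
  exact: geq_trans (bot_geq oe n) (iimg_geq oe q (bot oe Q)).
have Inq : Im os (n \o q) = top os _.
  by rewrite Im_comp (quotient_Im_s qq) -(quotient_Im_s qn).
rewrite -/oe Knq in quo_e; rewrite -/os Inq in emb_m.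
have [ee ue] := quo_e.
have [m' [m'm _]] := embedding_top_iso emb_m.
have [j [ej _]] : exists! j, e = j \o q by apply: uq; rewrite ee; exact: geq_refl.
have [i [ei _]] : exists! i, q = i \o e by apply: ue; rewrite eq_; exact: geq_refl.
have nj : n = m \o j by apply: (quotient_epi qq); rewrite -compA -ej.
have ij : i \o j = idm Q.
  by apply: (quotient_epi qq); rewrite comp1m -compA -ej -ei.
have n'n : (i \o m') \o n = idm Q by rewrite nj -compA (compA m') m'm comp1m.
rewrite -n'n -en.
exact: geq_trans (bot_geq oe (i \o m')) (iimg_geq oe n _).
Qed.

Lemma embedding_bot (X W : C) (m : hom W X) :
  is_embedding os (bot os X) m -> bot os W >= top os W.
Proof.
move=> qm; have [eI um] := qm.
have [[W' n] /= qn] := embedding_exists (bot os W); have [en _] := qn.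
have [Z [e [p [enq [emb_p quo_e]]]]] := of_factor w (m \o n).
have Imn : Im os (m \o n) = bot os X.
  apply: geq_antisym; first exact: bot_least.
  rewrite -[X in X >= _]eI; apply: dimg_least.
  exact: geq_trans (dimg_geq os m (top os W)) (top_geq os n).
have Kmn : Ker oe (m \o n) = bot oe _.
  by rewrite Ker_comp (embedding_Ker_e qm) -(embedding_Ker_e qn).
rewrite -/oe Kmn in quo_e; rewrite -/os Imn in emb_p.
have [ep up] := emb_p.
have [e' [_ ee']] := quotient_bot_iso quo_e.
have [j [ej _]] : exists! j, p = m \o j by apply: um; rewrite ep; exact: geq_refl.
have [i [ei _]] : exists! i, m = p \o i by apply: up; rewrite eI; exact: geq_refl.
have nj : n = j \o e by apply: (embedding_mono qm); rewrite compA -ej.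
have ji : j \o i = idm W.
  by apply: (embedding_mono qm); rewrite compm1 compA -ej -ei.
have nn' : n \o (e' \o i) = idm W by rewrite nj compA -(compA j) ee' compm1.
rewrite -nn' -en.
exact: geq_trans (dimg_geq os n _) (top_geq os (e' \o i)).
Qed.

Lemma quotient_Im_e (X Y : C) (R : cluster Fe X) (e : hom X Y) :
  is_quotient oe R e -> Im oe e = top oe Y.
Proof.
move=> qe; have [V [h eh]] := of_e_normal w (Im oe e); rewrite -/oe in eh.
apply: geq_antisym; last exact: top_largest.
rewrite eh; apply: iimg_largest.
have [Z [e1 [m1 [ehe [emb_m1 quo_e1]]]]] := of_factor w (h \o e).
have [Z' [e2 [m2 [eh2 [[em2 _] _]]]]] := of_factor w h.
have Khe : Ker oe (h \o e) = top oe X.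
  apply: geq_antisym; last exact: top_largest.
  apply: iimg_largest; apply: geq_trans (dimg_geq oe e (top oe X)).
  rewrite -/(Im oe e) eh; exact: iimg_geq.
rewrite -/oe Khe in quo_e1.
have Ihe : Im os (h \o e) = Im os h by rewrite Im_comp (quotient_Im_s qe).
rewrite -/os Ihe in emb_m1.
have [i [ei _]] : exists! i, m2 = m1 \o i.
  by apply: (proj2 emb_m1); rewrite em2; exact: geq_refl.
rewrite eh2 ei -compA.
apply: geq_trans (bot_geq oe m1) _.
exact: geq_transl (quotient_top quo_e1) (top_geq oe _).
Qed.

Lemma embedding_Ker_s (X Y : C) (A : cluster Fs Y) (m : hom X Y) :
  is_embedding os A m -> Ker os m = bot os X.
Proof.
move=> qm; have [V [h eh]] := of_s_conormal w (Ker os m); rewrite -/os in eh.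
apply: geq_antisym; first exact: bot_least.
rewrite eh; apply: dimg_least.
have [Z [e1 [m1 [emh [emb_m1 quo_e1]]]]] := of_factor w (m \o h).
have [Z' [e2 [m2 [eh2 [_ [ee2 _]]]]]] := of_factor w h.
have Imh : Im os (m \o h) = bot os Y.
  apply: geq_antisym; first exact: bot_least.
  apply: dimg_least; apply: geq_trans (iimg_geq os m (bot os Y)) _.
  rewrite -/(Ker os m) eh; exact: dimg_geq.
rewrite -/os Imh in emb_m1.
have Kmh : Ker oe (m \o h) = Ker oe h by rewrite Ker_comp (embedding_Ker_e qm).
rewrite -/oe Kmh in quo_e1.
have [i [ei _]] : exists! i, e2 = i \o e1.
  by apply: (proj2 quo_e1); rewrite ee2; exact: geq_refl.
rewrite eh2 ei compA.
apply: geq_trans _ (top_geq os e1).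
exact: geq_transr (bot_geq os _) (embedding_bot emb_m1).
Qed.

Lemma alpha_emb (X Y : C) (A : cluster Fs Y) (m : hom X Y) :
  is_embedding os A m -> op alpha A = Im oe m.
Proof.
have le (U V : C) (p : hom U Y) (q : hom V Y) :
    is_embedding os A p -> is_embedding os A q -> Im oe p >= Im oe q.
  move=> [_ up] [eq_ _].
  have [g [-> _]] : exists! g, q = p \o g.
    by apply: up; rewrite eq_; exact: geq_refl.
  by apply: dimg_least; apply: geq_trans (dimg_geq oe p _) (top_geq oe g).
move=> qm; have qA := embP A; exact: geq_antisym (le _ _ _ _ qA qm) (le _ _ _ _ qm qA).
Qed.

Lemma beta_quo (X Y : C) (R : cluster Fe X) (q : hom X Y) :
  is_quotient oe R q -> op beta R = Ker os q.
Proof.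
have le (U V : C) (p : hom X U) (q' : hom X V) :
    is_quotient oe R p -> is_quotient oe R q' -> Ker os q' >= Ker os p.
  move=> [_ up] [eq_ _].
  have [g [-> _]] : exists! g, q' = g \o p.
    by apply: up; rewrite eq_; exact: geq_refl.
  by apply: iimg_largest; apply: geq_trans (bot_geq os g) (iimg_geq os p _).
move=> qq; have qR := quoP R; exact: geq_antisym (le _ _ _ _ qq qR) (le _ _ _ _ qR qq).
Qed.

Lemma alpha_conormal : op_conormal os oe alpha.
Proof.
move=> X Y f; have [Z [e [m [ef [emb_m quo_e]]]]] := of_factor w f.
by rewrite (alpha_emb emb_m) ef Im_comp (quotient_Im_e quo_e).
Qed.

Lemma beta_normal : op_normal oe os beta.
Proof.
move=> X Y f; have [Z [e [m [ef [emb_m quo_e]]]]] := of_factor w f.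
by rewrite (beta_quo quo_e) ef Ker_comp (embedding_Ker_s emb_m).
Qed.

Lemma alpha_unique (a : operator Fs Fe) :
  op_conormal os oe a -> forall (X : C) (A : cluster Fs X), op a A = op alpha A.
Proof. by move=> a_con X A; have [eA _] := embP A; have := a_con _ _ (emb A); rewrite eA. Qed.

Lemma beta_unique (b : operator Fe Fs) :
  op_normal oe os b -> forall (X : C) (R : cluster Fe X), op b R = op beta R.
Proof. by move=> b_nor X R; have [eR _] := quoP R; have := b_nor _ _ (quo R); rewrite eR. Qed.

End OreanFactorization.

Section Conditions.
Variables (C : category) (Fs Fe : form C) (w : orean_factorization Fs Fe).
Let os : orean Fs := of_s w.
Let oe : orean Fe := of_e w.

Definition condition_i : Prop :=
  N1 oe /\
  forall (X Y : C) (f : hom X Y) (A : cluster Fs Y) (R : cluster Fe Y),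
    wyler_join w A R = A -> R >= op (alpha w) A ->
    Im os f >= A -> Im oe f >= R ->
    wyler_join w (dimg os f (iimg os f A)) R = A.

Definition condition_ii : Prop :=
  (forall (X : C) (A B : cluster Fs X),
    op (alpha w) (meet os A B) = meet oe (op (alpha w) A) (op (alpha w) B)) /\
  (forall (X : C) (A : cluster Fs X), A = wyler_join w A (op (alpha w) A)) /\
  (forall (X : C) (R : cluster Fe X), R >= op (alpha w) (op (beta w) R)).

Definition wyler_pair (p : dom (prod_form Fs Fe)) : Prop :=
  wyler_join w (prod_fst p) (prod_snd p) = prod_fst p /\
  prod_snd p >= op (alpha w) (prod_fst p).

Definition wyler_form : form C := subform wyler_pair.

End Conditions.

(* Main.v *)
From Stdlib Require Import ssreflect.
Require Import Defs.

(** If [G = G_s \/ G_e] is an exact join decomposition of a noetherian form,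
    then the operators [G -> G_s] and [G -> G_e] are right adjoint to the
    inclusions.  Hence they commute with inverse images and meets, and the
    inclusions with direct images and joins; by (N1), [A * R] is the [G_s]-part
    of [A \/ R], and [A \/ R] has the [G_e]-part [R] as soon as
    [R >= alpha A].  This identifies [G] with the pairs [(A, R)] such that
    [A * R = A] and [R >= alpha A], and gives (i) and (ii).

    Conversely, when [R >= alpha A] the least such pair above [(A, R)] is
    [(A * R, R)], so that the pairs form an orean form, with componentwise meets
    and inverse images.  Its conormal clusters are the pairs [(A, alpha A)] and
    its normal clusters the pairs [(beta R, R)].  The first half of (N1) comes
    from the identity [(n . B) . n = B] for embeddings [n], the second half is
    condition (i). *)

Set Implicit Arguments.
Unset Strict Implicit.
Unset Printing Implicit Defensive.

(** * Adjunction calculus of direct and inverse images *)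

Section OreanTheory.
Variables (C : category) (F : form C) (o : orean F).

Lemma dimg_le (X Y : C) (f : hom X Y) (S : cluster F X) (T : cluster F Y) :
  T >= dimg o f S -> T >=[f] S.
Proof. by move=> h; apply: geq_transl h (dimg_geq o f S). Qed.

Lemma iimg_ge (X Y : C) (f : hom X Y) (S : cluster F X) (T : cluster F Y) :
  iimg o f T >= S -> T >=[f] S.
Proof. by move=> h; apply: geq_transr (iimg_geq o f T) h. Qed.

(** This is (O2) in adjoint form: the intermediate cluster it provides lies above [dimg o f S].
    Functoriality of both images follows. *)
Lemma geq_comp (X Y Z : C) (f : hom X Y) (g : hom Y Z)
    (S : cluster F X) (T : cluster F Z) :
  T >=[g \o f] S <-> T >=[g] dimg o f S.
Proof.
split; last by move=> h; apply: geq_trans h (dimg_geq o f S).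
case/(geq_split o) => B [TB BS].
by apply: geq_transr TB _; apply: dimg_least.
Qed.

Lemma dimg_comp (X Y Z : C) (f : hom X Y) (g : hom Y Z) (S : cluster F X) :
  dimg o (g \o f) S = dimg o g (dimg o f S).
Proof.
apply: geq_antisym; apply: dimg_least.
  by apply/geq_comp; apply: dimg_geq.
by apply/geq_comp; apply: dimg_geq.
Qed.

Lemma iimg_comp (X Y Z : C) (f : hom X Y) (g : hom Y Z) (T : cluster F Z) :
  iimg o (g \o f) T = iimg o f (iimg o g T).
Proof.
apply: geq_antisym; apply: iimg_largest.
  exact: geq_trans (iimg_geq o g T) (iimg_geq o f _).
by apply: dimg_le; apply: iimg_largest; apply/geq_comp; apply: iimg_geq.
Qed.

Lemma dimg_mono (X Y : C) (f : hom X Y) (S S' : cluster F X) :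
  S' >= S -> dimg o f S' >= dimg o f S.
Proof. by move=> h; apply: dimg_least; apply: geq_transr (dimg_geq o f S') h. Qed.

Lemma iimg_mono (X Y : C) (f : hom X Y) (T T' : cluster F Y) :
  T' >= T -> iimg o f T' >= iimg o f T.
Proof. by move=> h; apply: iimg_largest; apply: geq_transl h (iimg_geq o f T). Qed.

Lemma join_absorb (X : C) (S T : cluster F X) : S >= T -> join o S T = S.
Proof.
move=> h; apply: geq_antisym; first exact: join_ubl.
exact: join_lub (geq_refl S) h.
Qed.

Lemma meet_absorb (X : C) (S T : cluster F X) : T >= S -> meet o S T = S.
Proof.
move=> h; apply: geq_antisym; last exact: meet_lbl.
exact: meet_glb (geq_refl S) h.
Qed.

Lemma iimg_Im (X Y : C) (f : hom X Y) : iimg o f (Im o f) = top o X.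
Proof.
apply: geq_antisym; last exact: top_largest.
by apply: iimg_largest; apply: dimg_geq.
Qed.

Lemma iimg_meet (X Y : C) (f : hom X Y) (S T : cluster F Y) :
  iimg o f (meet o S T) = meet o (iimg o f S) (iimg o f T).
Proof.
apply: geq_antisym.
  apply: iimg_largest; apply: dimg_le.
  by apply: meet_glb; apply: dimg_least; apply: iimg_ge;
    [apply: meet_lbl | apply: meet_lbr].
by apply: meet_glb; apply: iimg_mono; [apply: meet_lbl | apply: meet_lbr].
Qed.

Lemma dimg_join (X Y : C) (f : hom X Y) (S T : cluster F X) :
  dimg o f (join o S T) = join o (dimg o f S) (dimg o f T).
Proof.
apply: geq_antisym.
  by apply: join_lub; apply: dimg_mono; [apply: join_ubl | apply: join_ubr].
apply: dimg_least; apply: iimg_ge.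
by apply: join_lub; apply: iimg_largest; apply: dimg_le;
  [apply: join_ubl | apply: join_ubr].
Qed.

Lemma iimg_dimg_comp (X Y Z : C) (f : hom X Y) (g : hom Y Z) (S : cluster F X) :
  iimg o (g \o f) (dimg o (g \o f) S) >= iimg o f (dimg o f S).
Proof.
rewrite iimg_comp dimg_comp; apply: iimg_mono.
by apply: iimg_largest; apply: dimg_geq.
Qed.

End OreanTheory.

(** * Coreflections and isomorphisms of forms *)

Section Operators.
Variable C : category.

Definition op_comp (F G H : form C) (t : operator G H) (s : operator F G) :
    operator F H :=
  @Operator C F H (fun X A => op t (op s A))
    (fun X Y f A B BA => op_geq t (op_geq s BA)).

Lemma op_compE (F G H : form C) (t : operator G H) (s : operator F G) (X : C)
    (A : cluster F X) :
  op (op_comp t s) A = op t (op s A).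
Proof. by []. Qed.

Section Coreflection.
Variables (F G : form C) (oF : orean F) (oG : orean G).
Variables (inc : operator F G) (res : operator G F).
Hypothesis resK : forall (X : C) (A : cluster F X), op res (op inc A) = A.
Hypothesis inc_res : forall (X : C) (S : cluster G X), S >= op inc (op res S).

(** The adjunction [inc] left of [res], along every morphism. As a left adjoint [inc] commutes with
    direct images and joins; as a right adjoint [res] commutes with inverse images and meets. *)
Lemma coreflP (X Y : C) (f : hom X Y) (A : cluster F X) (T : cluster G Y) :
  T >=[f] op inc A <-> op res T >=[f] A.
Proof.
split=> [/(op_geq res) | /(op_geq inc)]; first by rewrite resK.
exact: geq_transl.
Qed.

Lemma inc_dimg (X Y : C) (f : hom X Y) (A : cluster F X) :
  op inc (dimg oF f A) = dimg oG f (op inc A).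
Proof.
apply: geq_antisym; first by apply: dimg_least; apply: op_geq; apply: dimg_geq.
apply/coreflP; apply: dimg_least; apply/coreflP; exact: dimg_geq.
Qed.

Lemma res_iimg (X Y : C) (f : hom X Y) (T : cluster G Y) :
  op res (iimg oG f T) = iimg oF f (op res T).
Proof.
apply: geq_antisym; last first.
  by apply: iimg_largest; apply: op_geq; apply: iimg_geq.
apply/coreflP; apply: iimg_largest; apply/coreflP; exact: iimg_geq.
Qed.

Lemma inc_join (X : C) (A B : cluster F X) :
  op inc (join oF A B) = join oG (op inc A) (op inc B).
Proof.
apply: geq_antisym.
  by apply: join_lub; apply: op_geq; [apply: join_ubl | apply: join_ubr].
by apply/coreflP; apply: join_lub; apply/coreflP; [apply: join_ubl | apply: join_ubr].
Qed.

Lemma res_meet (X : C) (S T : cluster G X) :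
  op res (meet oG S T) = meet oF (op res S) (op res T).
Proof.
apply: geq_antisym; last first.
  by apply: meet_glb; apply: op_geq; [apply: meet_lbl | apply: meet_lbr].
by apply/coreflP; apply: meet_glb; apply/coreflP; [apply: meet_lbl | apply: meet_lbr].
Qed.

End Coreflection.

Section Isomorphism.
Variables (F G : form C) (s : operator F G) (t : operator G F).
Hypothesis sK : forall (X : C) (A : cluster F X), op t (op s A) = A.
Hypothesis tK : forall (X : C) (B : cluster G X), op s (op t B) = B.

Lemma iso_geq (X Y : C) (f : hom X Y) (A : cluster F X) (B : cluster G Y) :
  B >=[f] op s A <-> op t B >=[f] A.
Proof.
by split=> [/(op_geq t) | /(op_geq s)]; rewrite ?sK ?tK.
Qed.

Lemma geq_iso (X Y : C) (f : hom X Y) (A : cluster G X) (B : cluster F Y) :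
  op s B >=[f] A <-> B >=[f] op t A.
Proof.
by split=> [/(op_geq t) | /(op_geq s)]; rewrite ?sK ?tK.
Qed.

Definition orean_transport (o : orean F) : orean G.
Proof.
refine (@Orean C G (fun X => op s (bot o X)) (fun X => op s (top o X))
  (fun X A B => op s (join o (op t A) (op t B)))
  (fun X A B => op s (meet o (op t A) (op t B))) _ _ _ _ _ _ _ _ _
  (fun X Y f A => op s (dimg o f (op t A))) _ _
  (fun X Y f B => op s (iimg o f (op t B))) _ _).
- by move=> X A; apply/iso_geq; apply: bot_least.
- by move=> X A; apply/geq_iso; apply: top_largest.
- by move=> X A B; apply/geq_iso; apply: join_ubl.
- by move=> X A B; apply/geq_iso; apply: join_ubr.
- by move=> X A B U UA UB; apply/iso_geq; apply: join_lub; apply: op_geq.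
- by move=> X A B; apply/iso_geq; apply: meet_lbl.
- by move=> X A B; apply/iso_geq; apply: meet_lbr.
- by move=> X A B U UA UB; apply/geq_iso; apply: meet_glb; apply: op_geq.
- move=> X Y Z f g A D /(op_geq t) /(geq_split o) [B [DB BA]].
  by exists (op s B); split; [apply/iso_geq | apply/geq_iso].
- by move=> X Y f A; apply/geq_iso; apply: dimg_geq.
- by move=> X Y f A B BA; apply/iso_geq; apply: dimg_least; apply: op_geq.
- by move=> X Y f B; apply/iso_geq; apply: iimg_geq.
- by move=> X Y f A B BA; apply/geq_iso; apply: iimg_largest; apply: op_geq.
Defined.

Variables (oF : orean F) (oG : orean G).

Lemma iso_top (X : C) : op s (top oF X) = top oG X.
Proof.
apply: geq_antisym; last exact: top_largest.
by apply/geq_iso; apply: top_largest.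
Qed.

Lemma iso_bot (X : C) : op s (bot oF X) = bot oG X.
Proof.
apply: geq_antisym; first exact: bot_least.
by apply/iso_geq; apply: bot_least.
Qed.

(** An isomorphism is a coreflection in both directions, hence both a left and a right adjoint. *)
Lemma iso_binormal : op_binormal oF oG s.
Proof.
have le (X : C) (B : cluster G X) : B >= op s (op t B).
  by rewrite tK; apply: geq_refl.
have le' (X : C) (A : cluster F X) : A >= op t (op s A).
  by rewrite sK; apply: geq_refl.
split=> X Y f; rewrite /Im /Ker.
  by rewrite (inc_dimg oF oG sK le) iso_top.
by rewrite (res_iimg oG oF tK le') iso_bot.
Qed.

Lemma iso_conormal_form : conormal_form oF -> conormal_form oG.
Proof.
move=> cF X B; have [W [f e]] := cF X (op t B); exists W, f.
by rewrite -(proj1 iso_binormal) -e tK.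
Qed.

Lemma iso_normal_form : normal_form oF -> normal_form oG.
Proof.
move=> nF X B; have [W [f e]] := nF X (op t B); exists W, f.
by rewrite -(proj2 iso_binormal) -e tK.
Qed.

End Isomorphism.
End Operators.

(** * Subforms of fixed clusters, and exact decompositions up to isomorphism *)

Section SubformTheory.
Variables (C : category) (F : form C).

Lemma sub_geqP (P : dom F -> Prop) (X Y : C) (f : hom X Y)
    (A : cluster (subform P) X) (B : cluster (subform P) Y) :
  B >=[f] A <-> op (sub_incl P) B >=[f] op (sub_incl P) A.
Proof. by []. Qed.

Lemma sub_incl_inj (P : dom F -> Prop) (X : C) (A B : cluster (subform P) X) :
  op (sub_incl P) A = op (sub_incl P) B -> A = B.
Proof.
by move=> e; apply: geq_antisym; apply/sub_geqP; rewrite e; apply: geq_refl.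
Qed.

Lemma sub_incl_sub_cluster (P : dom F -> Prop) (X : C) (A : cluster F X)
    (pA : P (proj1_sig A)) :
  op (sub_incl P) (sub_cluster pA) = A.
Proof. by case: A pA. Qed.

Variables (t : operator F F) (t_idem : op_idempotent t).

Lemma fixed_restrE (X : C) (S : cluster F X) :
  op (sub_incl (fixed t)) (op (fixed_restr t_idem) S) = op t S.
Proof. exact: sub_incl_sub_cluster. Qed.

Lemma fixed_inclE (X : C) (S : cluster (fixed_form t) X) :
  op t (op (sub_incl (fixed t)) S) = op (sub_incl (fixed t)) S.
Proof. by apply/fixedP; case: S => -[]. Qed.

Lemma fixed_restr_incl (X : C) (S : cluster (fixed_form t) X) :
  op (fixed_restr t_idem) (op (sub_incl (fixed t)) S) = S.
Proof. by apply: sub_incl_inj; rewrite fixed_restrE fixed_inclE. Qed.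

End SubformTheory.

(* Up to isomorphism of [F_s] and [F_e], the data of an exact join decomposition;
   the conormal and normal operators between [F_s] and [F_e] are then
   [res_e \o inc_s] and [res_s \o inc_e]. *)
Record exact_split (C : category) (G Fs Fe : form C) (o : orean G)
    (os : orean Fs) (oe : orean Fe) := ExactSplit {
  res_s : operator G Fs;
  inc_s : operator Fs G;
  res_e : operator G Fe;
  inc_e : operator Fe G;
  res_sK : forall (X : C) (A : cluster Fs X), op res_s (op inc_s A) = A;
  res_eK : forall (X : C) (R : cluster Fe X), op res_e (op inc_e R) = R;
  split_join : forall (X : C) (S : cluster G X),
    S = join o (op inc_s (op res_s S)) (op inc_e (op res_e S));
  res_s_binormal : op_binormal o os res_s;
  res_e_binormal : op_binormal o oe res_e;
  inc_s_conormal : op_conormal os o inc_s;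
  inc_e_normal : op_normal oe o inc_e
}.

(** The structures [os] and [oe] are arbitrary, since isomorphisms preserve images and kernels for
    any choice of them; the uniqueness claim can thus start from a given factorization. *)
Lemma exact_split_of_jd (C : category) (G Fs Fe : form C) (o : orean G)
    (d : join_decomposition o) (os : orean Fs) (oe : orean Fe) :
  jd_exact d -> form_iso (jd_form_s d) Fs -> form_iso (jd_form_e d) Fe ->
  inhabited (exact_split o os oe).
Proof.
case=> bs be _ _ cs ne [u [v [uK vK]]] [x [y [xK yK]]].
have [u_con u_nor] := iso_binormal uK vK (jd_s_orean d) os.
have [v_con _] := iso_binormal vK uK os (jd_s_orean d).
have [x_con x_nor] := iso_binormal xK yK (jd_e_orean d) oe.
have [_ y_nor] := iso_binormal yK xK oe (jd_e_orean d).
constructor; refine (@ExactSplit C G Fs Fe o os oe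
  (op_comp u (fixed_restr (jd_s_idem d))) (op_comp (sub_incl (fixed (jd_s d))) v)
  (op_comp x (fixed_restr (jd_e_idem d))) (op_comp (sub_incl (fixed (jd_e d))) y)
  _ _ _ _ _ _ _).
- by move=> X A; rewrite !op_compE fixed_restr_incl vK.
- by move=> X A; rewrite !op_compE fixed_restr_incl yK.
- move=> X S; rewrite {1}(jd_join d S) -!(fixed_restrE (jd_s_idem d)).
  by rewrite -!(fixed_restrE (jd_e_idem d)) !op_compE uK xK.
- by split=> X Y f; rewrite op_compE ?(proj1 bs) ?(proj2 bs) ?u_con ?u_nor.
- by split=> X Y f; rewrite op_compE ?(proj1 be) ?(proj2 be) ?x_con ?x_nor.
- by move=> X Y f; rewrite !op_compE v_con cs.
- by move=> X Y f; rewrite !op_compE y_nor ne.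
Qed.

(** * From split data back to an exact join decomposition *)

Section Retract.
Variables (C : category) (F G : form C).
Variables (inc : operator F G) (res : operator G F).
Hypothesis resK : forall (X : C) (A : cluster F X), op res (op inc A) = A.

Lemma retract_idem : op_idempotent (op_comp inc res).
Proof. by move=> X S; rewrite /= resK. Qed.

Definition of_fixed : operator (fixed_form (op_comp inc res)) F :=
  op_comp res (sub_incl _).
Definition to_fixed : operator F (fixed_form (op_comp inc res)) :=
  op_comp (fixed_restr retract_idem) inc.

Lemma to_fixedE (X : C) (A : cluster F X) :
  op (sub_incl _) (op to_fixed A) = op inc A.
Proof. by rewrite op_compE fixed_restrE /= resK. Qed.

Lemma fixed_restr_to_fixed (X : C) (S : cluster G X) :
  op (fixed_restr retract_idem) S = op to_fixed (op res S).
Proof. by apply: sub_incl_inj; rewrite to_fixedE fixed_restrE. Qed.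

Lemma to_fixedK (X : C) (A : cluster F X) : op of_fixed (op to_fixed A) = A.
Proof. by rewrite op_compE to_fixedE resK. Qed.

Lemma of_fixedK (X : C) (S : cluster (fixed_form (op_comp inc res)) X) :
  op to_fixed (op of_fixed S) = S.
Proof. by apply: sub_incl_inj; rewrite to_fixedE -[RHS]fixed_inclE. Qed.

Lemma form_iso_fixed : form_iso (fixed_form (op_comp inc res)) F.
Proof. exists of_fixed, to_fixed; split; [exact: of_fixedK | exact: to_fixedK]. Qed.

End Retract.

Section JdOfSplit.
Variables (C : category) (G Fs Fe : form C) (o : orean G).
Variables (os : orean Fs) (oe : orean Fe) (p : exact_split o os oe).
Hypotheses (os_conormal : conormal_form os) (oe_normal : normal_form oe).

Let cs := to_fixedK (res_sK p).
Let csV := of_fixedK (res_sK p).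
Let ce := to_fixedK (res_eK p).
Let ceV := of_fixedK (res_eK p).
Let fs := orean_transport cs csV os.
Let fe := orean_transport ce ceV oe.

(** The idempotents, inferred from [retract_idem], are [inc_s] after [res_s] and [inc_e] after
    [res_e]. *)
Definition jd_of_split : join_decomposition o :=
  @JoinDecomposition C G o _ _ (retract_idem (res_sK p)) (retract_idem (res_eK p))
    fs (iso_conormal_form cs csV (oF := os) fs os_conormal)
    fe (iso_normal_form ce ceV (oF := oe) fe oe_normal) (split_join p).

Lemma jd_of_split_exact : jd_exact jd_of_split.
Proof.
have [s_con s_nor] := iso_binormal cs csV os fs.
have [e_con e_nor] := iso_binormal ce ceV oe fe.
have [s'_con s'_nor] := iso_binormal csV cs fs os.
have [e'_con e'_nor] := iso_binormal ceV ce fe oe.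
have [rs_con rs_nor] := res_s_binormal p.
have [re_con re_nor] := res_e_binormal p.
split.
- split=> X Y f; rewrite [LHS](fixed_restr_to_fixed (res_sK p)).
    by rewrite rs_con s_con.
  by rewrite rs_nor s_nor.
- split=> X Y f; rewrite [LHS](fixed_restr_to_fixed (res_eK p)).
    by rewrite re_con e_con.
  by rewrite re_nor e_nor.
(* The operator passes from the fixed subform to [Fs], then into [G], down to [Fe] and back to a
   fixed subform; each stage preserves images. *)
- exists (op_comp (to_fixed (res_eK p))
    (op_comp (op_comp (res_e p) (inc_s p)) (of_fixed (inc_s p) (res_s p)))).
  move=> X Y f; transitivity (op (to_fixed (res_eK p)) (op (res_e p)
    (op (inc_s p) (op (of_fixed (inc_s p) (res_s p)) (Im fs f))))); first by [].
  by rewrite s'_con inc_s_conormal re_con e_con.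
- exists (op_comp (to_fixed (res_sK p))
    (op_comp (op_comp (res_s p) (inc_e p)) (of_fixed (inc_e p) (res_e p)))).
  move=> X Y f; transitivity (op (to_fixed (res_sK p)) (op (res_s p)
    (op (inc_e p) (op (of_fixed (inc_e p) (res_e p)) (Ker fe f))))); first by [].
  by rewrite e'_nor inc_e_normal rs_nor s_nor.
- by move=> X Y f; rewrite -[X in op _ X]s_con to_fixedE inc_s_conormal.
- by move=> X Y f; rewrite -[X in op _ X]e_nor to_fixedE inc_e_normal.
Qed.

End JdOfSplit.

(** * The Wyler join in an orean factorization *)

Section FactorizationTheory.
Variables (C : category) (Fs Fe : form C) (w : orean_factorization Fs Fe).
Let os : orean Fs := of_s w.
Let oe : orean Fe := of_e w.

(** Every [Fs]-cluster is an image, and the direct image of an image is the image of a composite. *)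
Lemma alpha_dimg (X Y : C) (f : hom X Y) (A : cluster Fs X) :
  op (alpha w) (dimg os f A) = dimg oe f (op (alpha w) A).
Proof.
have [<- _] := embP w A.
by rewrite -Im_comp !(alpha_conormal w) Im_comp.
Qed.

Lemma Ker_quo (X : C) (R : cluster Fe X) : Ker oe (quo w R) = R.
Proof. by case: (quoP w R). Qed.

Lemma wyler_join_ge (X : C) (A : cluster Fs X) (R : cluster Fe X) :
  wyler_join w A R >= A.
Proof. by apply: iimg_largest; apply: dimg_geq. Qed.

Lemma wyler_join_beta (X : C) (A : cluster Fs X) (R : cluster Fe X) :
  wyler_join w A R >= op (beta w) R.
Proof. by apply: iimg_mono; apply: bot_least. Qed.

(** The quotient of [Q] composed with [f] has kernel above [R], so it factors through the quotient
    of [R]. *)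
Lemma wyler_join_geq (X Y : C) (f : hom X Y) (A : cluster Fs X) (B : cluster Fs Y)
    (R : cluster Fe X) (Q : cluster Fe Y) :
  B >=[f] A -> Q >=[f] R -> wyler_join w B Q >=[f] wyler_join w A R.
Proof.
move=> BA QR.
have KR : Ker oe (quo w Q \o f) >= R.
  by rewrite Ker_comp Ker_quo; apply: iimg_largest.
have [h [eh _]] := proj2 (quoP w R) _ _ KR.
apply: (iimg_ge (o := os)); rewrite /wyler_join -iimg_comp eh; apply: iimg_largest.
apply: geq_trans _ (iimg_geq os _ _); apply/geq_comp.
by rewrite -eh; apply: geq_trans (dimg_geq os _ _) BA.
Qed.

Lemma wyler_join_idem (X : C) (A : cluster Fs X) (R : cluster Fe X) :
  wyler_join w (wyler_join w A R) R = wyler_join w A R.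
Proof.
apply: geq_antisym; first exact: wyler_join_ge.
by apply: iimg_mono; apply: dimg_least; apply: iimg_geq.
Qed.

Lemma wyler_join_beta_l (X : C) (R : cluster Fe X) :
  wyler_join w (op (beta w) R) R = op (beta w) R.
Proof.
apply: geq_antisym; first exact: wyler_join_ge.
by apply: iimg_mono; apply: dimg_least; apply: iimg_geq.
Qed.

End FactorizationTheory.

(** * Necessity: the factorization and conditions (i), (ii) *)

Section SplitFactorization.
Variables (C : category) (G Fs Fe : form C) (o : orean G).
Variables (os : orean Fs) (oe : orean Fe) (p : exact_split o os oe).

Lemma inc_res_s (X : C) (S : cluster G X) : S >= op (inc_s p) (op (res_s p) S).
Proof. by rewrite {1}(split_join p S); apply: join_ubl. Qed.

Lemma inc_res_e (X : C) (S : cluster G X) : S >= op (inc_e p) (op (res_e p) S).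
Proof. by rewrite {1}(split_join p S); apply: join_ubr. Qed.

(** Conormality of [inc_s] lifts an inequality between images from [Fs] to [G], where the universal
    property is available. *)
Lemma split_embedding (X Y W : C) (f : hom X Y) (m : hom W Y) :
  is_embedding o (Im o f) m -> is_embedding os (Im os f) m.
Proof.
have [rs_con _] := res_s_binormal p.
case=> e u; split; first by rewrite -!rs_con e.
move=> V k /(op_geq (inc_s p)); rewrite !(inc_s_conormal p); exact: u.
Qed.

Lemma split_quotient (X Y W : C) (f : hom X Y) (q : hom X W) :
  is_quotient o (Ker o f) q -> is_quotient oe (Ker oe f) q.
Proof.
have [_ re_nor] := res_e_binormal p.
case=> e u; split; first by rewrite -!re_nor e.
move=> V k /(op_geq (inc_e p)); rewrite !(inc_e_normal p); exact: u.
Qed.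

Lemma split_factor (X Y : C) (f : hom X Y) :
  N2 o -> exists (Z : C) (e : hom X Z) (m : hom Z Y),
    f = m \o e /\ is_embedding os (Im os f) m /\ is_quotient oe (Ker oe f) e.
Proof.
move=> n2; have [Z [e [m [-> [em qe]]]]] := n2 X Y f; exists Z, e, m; split=> //.
by split; [apply: split_embedding em | apply: split_quotient qe].
Qed.

End SplitFactorization.

Section Necessity.
Variables (C : category) (G Fs Fe : form C) (o : orean G).
Variables (w : orean_factorization Fs Fe).
Let os : orean Fs := of_s w.
Let oe : orean Fe := of_e w.
Variable p : exact_split o os oe.
Hypothesis o_noeth : noetherian o.

Let is_ := inc_s p.
Let ie := inc_e p.
Let rs := res_s p.
Let re := res_e p.

Lemma alphaE (X : C) (A : cluster Fs X) : op (alpha w) A = op re (op is_ A).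
Proof.
rewrite -(alpha_unique (a := op_comp re is_)) // => U V f.
by rewrite op_compE (inc_s_conormal p) (proj1 (res_e_binormal p)).
Qed.

Lemma betaE (X : C) (R : cluster Fe X) : op (beta w) R = op rs (op ie R).
Proof.
rewrite -(beta_unique (b := op_comp rs ie)) // => U V f.
by rewrite op_compE (inc_e_normal p) (proj2 (res_s_binormal p)).
Qed.

(** (N1) in [G] for the quotient of [R], whose kernel in [G] is [op ie R]. Applying [rs] turns the
    right side into the Wyler join. *)
Lemma saturation_quo (X : C) (A : cluster Fs X) (R : cluster Fe X) :
  join o (op is_ A) (op ie R) =
    iimg o (quo w R) (op is_ (dimg os (quo w R) A)).
Proof.
have [n1 _] := o_noeth.
rewrite (inc_dimg os o (res_sK p) (inc_res_s p)) (proj1 (n1 _ _ _)).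
by rewrite -(inc_e_normal p) Ker_quo.
Qed.

Lemma wyler_joinE (X : C) (A : cluster Fs X) (R : cluster Fe X) :
  wyler_join w A R = op rs (join o (op is_ A) (op ie R)).
Proof.
by rewrite saturation_quo (res_iimg os o (res_sK p) (inc_res_s p)) (res_sK p).
Qed.

(** [Fe]-clusters are kernels, and an inverse image of a kernel is the kernel of a composite. So the
    left adjoint [ie] commutes with inverse images too. *)
Lemma normal_iimg (X Y : C) (f : hom X Y) (R : cluster Fe Y) :
  op ie (iimg oe f R) = iimg o f (op ie R).
Proof. by rewrite -(Ker_quo w R) -Ker_comp !(inc_e_normal p) Ker_comp. Qed.

Lemma split_N1 : N1 oe.
Proof.
have [n1 _] := o_noeth.
have ie_dimg := inc_dimg oe o (res_eK p) (inc_res_e p).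
have ie_join := inc_join oe o (res_eK p).
move=> X Y f; split=> R; rewrite -[LHS](res_eK p).
  rewrite normal_iimg ie_dimg (proj1 (n1 _ _ f)) -(inc_e_normal p).
  by rewrite -(inc_join oe o (res_eK p) (inc_res_e p)) res_eK.
rewrite ie_dimg normal_iimg (proj2 (n1 _ _ f)).
rewrite (res_meet oe o (res_eK p) (inc_res_e p)) (res_eK p).
by rewrite (proj1 (res_e_binormal p)).
Qed.

(** Written as an inverse image along the quotient of [R], the join restricts in [Fe] to the
    saturation of [alpha A], which is [alpha A] joined with [R] by (N1) for [oe]. *)
Lemma res_e_join (X : C) (A : cluster Fs X) (R : cluster Fe X) :
  R >= op (alpha w) A -> op re (join o (op is_ A) (op ie R)) = R.
Proof.
move=> RA; rewrite saturation_quo (res_iimg oe o (res_eK p) (inc_res_e p)).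
rewrite -alphaE alpha_dimg (proj1 (split_N1 _)) Ker_quo.
by apply: geq_antisym; [apply: join_ubr | apply: join_lub (geq_refl R)].
Qed.

Lemma split_condition_ii : condition_ii w.
Proof.
have [n1 [n2 n3]] := o_noeth.
split; [|split].
- move=> X A B; rewrite !alphaE -(res_meet oe o (res_eK p) (inc_res_e p)).
  have con (D : cluster Fs X) : conormal_cluster o (op is_ D).
    have [W [f ->]] := of_s_conormal w D.
    by exists W, f; rewrite (inc_s_conormal p).
  (* By (N3) the meet in [G] is an image, and images are fixed by [is_] after [rs]; so [is_]
     preserves this meet. *)
  have [_ /(_ (con A) (con B)) [W [f ef]]] := n3 X (op is_ A) (op is_ B).
  have : op is_ (op rs (Im o f)) = Im o f.
    by rewrite (proj1 (res_s_binormal p)) (inc_s_conormal p).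
  rewrite -ef (res_meet os o (res_sK p) (inc_res_s p)) !(res_sK p).
  by move=> ->.
- move=> X A; rewrite wyler_joinE alphaE join_absorb ?(res_sK p) //.
  exact: (inc_res_e p).
- move=> X R; rewrite alphaE betaE -[X in X >= _](res_eK p).
  by apply: op_geq; apply: (inc_res_s p).
Qed.

Lemma split_condition_i : condition_i w.
Proof.
have [n1 _] := o_noeth.
split; first exact: split_N1.
move=> X Y f A R AR RA fA fR.
set S := join o (op is_ A) (op ie R).
have SA : op rs S = A by rewrite -wyler_joinE.
have SR : op re S = R by exact: res_e_join.
have fS : Im o f >= S.
  apply: join_lub; first by rewrite -(inc_s_conormal p); apply: op_geq.
  apply: geq_transl (inc_res_e p _) _; apply: op_geq.
  by rewrite (proj1 (res_e_binormal p)).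
have eS : dimg o f (iimg o f S) = S.
  by rewrite (proj2 (n1 _ _ f)) meet_absorb.
have eR : dimg oe f (iimg oe f R) = R.
  by rewrite (proj2 (split_N1 f)) meet_absorb.
(* Now [S] is the direct image of its inverse image. Splitting the latter into its two parts and
   pushing each forward, the second part returns [R]. *)
rewrite wyler_joinE -{2}SA -eS; congr (op _ _).
rewrite {1}(split_join p (iimg o f S)) dimg_join.
rewrite (res_iimg os o (res_sK p) (inc_res_s p)) SA.
rewrite (res_iimg oe o (res_eK p) (inc_res_e p)) SR.
rewrite -(inc_dimg os o (res_sK p) (inc_res_s p)).
by rewrite -(inc_dimg oe o (res_eK p) (inc_res_e p)) eR.
Qed.

Lemma split_wyler_pair (X : C) (S : cluster G X) :
  wyler_join w (op rs S) (op re S) = op rs S /\ op re S >= op (alpha w) (op rs S).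
Proof.
split; first by rewrite wyler_joinE -(split_join p).
by rewrite alphaE; apply: op_geq; apply: (inc_res_s p).
Qed.

End Necessity.

(** * Clusters of the product and of the form of Wyler pairs *)

Section ProductTheory.
Variables (C : category) (F G : form C).

Definition pair_cluster (X : C) (A : cluster F X) (R : cluster G X) :
    cluster (prod_form F G) X :=
  exist (fun P : dom (prod_form F G) => prod_form F G P = X) (ProdOb A R) eq_refl.

(** The component lies over the base of the pair; it is carried to [X] along the equation stored in
    the cluster. *)
Definition fst_cluster (X : C) (P : cluster (prod_form F G) X) : cluster F X :=
  match proj2_sig P in _ = Y return cluster F Y with
  | eq_refl => prod_fst (proj1_sig P)
  end.

Definition snd_cluster (X : C) (P : cluster (prod_form F G) X) : cluster G X :=
  match proj2_sig P in _ = Y return cluster G Y with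
  | eq_refl => prod_snd (proj1_sig P)
  end.

Lemma prod_geqP (X Y : C) (f : hom X Y) (P : cluster (prod_form F G) X)
    (Q : cluster (prod_form F G) Y) :
  Q >=[f] P <->
  fst_cluster Q >=[f] fst_cluster P /\ snd_cluster Q >=[f] snd_cluster P.
Proof.
case: P => [[U A R] /= eU]; case: Q => [[V B S] /= eV]; subst X Y.
rewrite /fst_cluster /snd_cluster /=; split.
  by case=> -[h [hA hR]] /= <-.
by move=> fg; exists (exist _ f fg).
Qed.

End ProductTheory.

Section WylerForm.
Variables (C : category) (Fs Fe : form C) (w : orean_factorization Fs Fe).
Let os : orean Fs := of_s w.
Let oe : orean Fe := of_e w.
Let W : form C := wyler_form w.

Definition wyler_fst (X : C) (S : cluster W X) : cluster Fs X :=
  fst_cluster (op (sub_incl _) S).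
Definition wyler_snd (X : C) (S : cluster W X) : cluster Fe X :=
  snd_cluster (op (sub_incl _) S).
Definition wyler_mk (X : C) (A : cluster Fs X) (R : cluster Fe X)
    (AR : wyler_join w A R = A /\ R >= op (alpha w) A) : cluster W X :=
  sub_cluster (A := pair_cluster A R) AR.

Lemma wyler_geqP (X Y : C) (f : hom X Y) (S : cluster W X) (T : cluster W Y) :
  T >=[f] S <-> wyler_fst T >=[f] wyler_fst S /\ wyler_snd T >=[f] wyler_snd S.
Proof. by split=> [/sub_geqP /prod_geqP | ?]; last by apply/sub_geqP/prod_geqP. Qed.

Lemma wyler_clusterP (X : C) (S : cluster W X) :
  wyler_join w (wyler_fst S) (wyler_snd S) = wyler_fst S /\
  wyler_snd S >= op (alpha w) (wyler_fst S).
Proof. by case: S => -[P h] /= e; subst X. Qed.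

Lemma wyler_ext (X : C) (S T : cluster W X) :
  wyler_fst S = wyler_fst T -> wyler_snd S = wyler_snd T -> S = T.
Proof.
by move=> e1 e2; apply: geq_antisym; apply/wyler_geqP; rewrite e1 e2;
  split; apply: geq_refl.
Qed.

Definition wyler_fst_op : operator W Fs :=
  @Operator C W Fs wyler_fst (fun X Y f A B h => proj1 (proj1 (wyler_geqP f A B) h)).
Definition wyler_snd_op : operator W Fe :=
  @Operator C W Fe wyler_snd (fun X Y f A B h => proj2 (proj1 (wyler_geqP f A B) h)).

End WylerForm.

(** The inverse operators send [S] to its pair of parts and [(A, R)] to the join of the two
    inclusions. *)
Lemma wyler_form_iso (C : category) (G Fs Fe : form C) (o : orean G)
    (w : orean_factorization Fs Fe) (p : exact_split o (of_s w) (of_e w)) :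
  noetherian o -> form_iso G (wyler_form w).
Proof.
move=> o_noeth.
have to_geq (X Y : C) (f : hom X Y) (S : cluster G X) (T : cluster G Y) :
    T >=[f] S ->
    wyler_mk (split_wyler_pair p o_noeth T) >=[f]
    wyler_mk (split_wyler_pair p o_noeth S).
  by move=> TS; apply/wyler_geqP; split; apply: op_geq.
have from_geq (X Y : C) (f : hom X Y) (S : cluster (wyler_form w) X)
    (T : cluster (wyler_form w) Y) : T >=[f] S ->
    join o (op (inc_s p) (wyler_fst T)) (op (inc_e p) (wyler_snd T)) >=[f]
    join o (op (inc_s p) (wyler_fst S)) (op (inc_e p) (wyler_snd S)).
  case/wyler_geqP=> TS1 TS2; apply: (iimg_ge (o := o)); apply: join_lub.
    by apply: iimg_largest; apply: geq_transl (join_ubl o _ _) _; apply: op_geq.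
  by apply: iimg_largest; apply: geq_transl (join_ubr o _ _) _; apply: op_geq.
exists (Operator to_geq), (Operator from_geq); split=> X S /=.
  exact: (eq_sym (split_join p S)).
have [S1 S2] := wyler_clusterP S.
apply: wyler_ext; first by rewrite -[LHS](wyler_joinE p o_noeth).
exact: (res_e_join p o_noeth).
Qed.

(** * Sufficiency: the Wyler pairs form a noetherian form *)

Section Sufficiency.
Variables (C : category) (Fs Fe : form C) (w : orean_factorization Fs Fe).
Let os : orean Fs := of_s w.
Let oe : orean Fe := of_e w.
Let W : form C := wyler_form w.
Hypotheses (wi : condition_i w) (wii : condition_ii w).

Let oe_N1 : N1 oe := proj1 wi.
Let alpha_meet := proj1 wii.
Let wyler_join_alpha := proj1 (proj2 wii).
Let alpha_beta := proj2 (proj2 wii).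

(** [alpha] sends the saturation of [A] below that of [alpha A], and the latter is [alpha A] joined
    with [R] by (N1) for [oe]. *)
Lemma alpha_wyler_join (X : C) (A : cluster Fs X) (R : cluster Fe X) :
  R >= op (alpha w) A -> R >= op (alpha w) (wyler_join w A R).
Proof.
move=> RA; suff : iimg oe (quo w R) (dimg oe (quo w R) (op (alpha w) A)) >=
    op (alpha w) (wyler_join w A R).
  by apply: geq_transl; rewrite (proj1 (oe_N1 _)) Ker_quo; apply: join_lub (geq_refl R).
rewrite -alpha_dimg; apply: iimg_largest; apply: op_geq; exact: iimg_geq.
Qed.

Definition wyler_sat (X : C) (A : cluster Fs X) (R : cluster Fe X)
    (RA : R >= op (alpha w) A) : cluster W X :=
  wyler_mk (conj (wyler_join_idem w A R) (alpha_wyler_join RA)).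

(** The first component of a pair is its own Wyler join with the second, so monotonicity of the
    Wyler join applies. *)
Lemma wyler_sat_least (X Y : C) (f : hom X Y) (A : cluster Fs X) (R : cluster Fe X)
    (RA : R >= op (alpha w) A) (T : cluster W Y) :
  wyler_fst T >=[f] A -> wyler_snd T >=[f] R -> T >=[f] wyler_sat RA.
Proof.
move=> TA TR; apply/wyler_geqP; split=> //.
have [<- _] := wyler_clusterP T; exact: wyler_join_geq.
Qed.

Lemma alpha_bot (X : C) : op (alpha w) (bot os X) = bot oe X.
Proof.
apply: geq_antisym; first exact: bot_least.
by apply: geq_transl (alpha_beta _) _; apply: op_geq; apply: bot_least.
Qed.

Lemma wyler_join_bot (X : C) (A : cluster Fs X) : wyler_join w A (bot oe X) = A.
Proof.
apply: geq_antisym; first exact: wyler_join_ge.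
rewrite -alpha_bot [X in X >= _]wyler_join_alpha.
by apply: wyler_join_geq; [apply: geq_refl | apply: op_geq; apply: bot_least].
Qed.

Lemma wyler_botP (X : C) :
  wyler_join w (bot os X) (bot oe X) = bot os X /\
  bot oe X >= op (alpha w) (bot os X).
Proof. by rewrite wyler_join_bot alpha_bot; split=> //; apply: geq_refl. Qed.

Lemma wyler_topP (X : C) :
  wyler_join w (top os X) (top oe X) = top os X /\
  top oe X >= op (alpha w) (top os X).
Proof.
split; last exact: top_largest.
by apply: geq_antisym; [apply: wyler_join_ge | apply: top_largest].
Qed.

Lemma wyler_meetP (X : C) (S T : cluster W X) :
  wyler_join w (meet os (wyler_fst S) (wyler_fst T))
      (meet oe (wyler_snd S) (wyler_snd T)) = meet os (wyler_fst S) (wyler_fst T) /\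
  meet oe (wyler_snd S) (wyler_snd T) >=
    op (alpha w) (meet os (wyler_fst S) (wyler_fst T)).
Proof.
have [S1 S2] := wyler_clusterP S; have [T1 T2] := wyler_clusterP T; split.
  apply: geq_antisym; first exact: wyler_join_ge.
  by apply: meet_glb; [rewrite -[X in X >= _]S1 | rewrite -[X in X >= _]T1];
    apply: wyler_join_geq; (apply: meet_lbl || apply: meet_lbr).
rewrite alpha_meet; apply: meet_glb.
  exact: geq_transl S2 (meet_lbl _ _ _).
exact: geq_transl T2 (meet_lbr _ _ _).
Qed.

Lemma wyler_iimgP (X Y : C) (f : hom X Y) (T : cluster W Y) :
  wyler_join w (iimg os f (wyler_fst T)) (iimg oe f (wyler_snd T)) =
    iimg os f (wyler_fst T) /\
  iimg oe f (wyler_snd T) >= op (alpha w) (iimg os f (wyler_fst T)).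
Proof.
have [T1 T2] := wyler_clusterP T; split.
  apply: geq_antisym; first exact: wyler_join_ge.
  apply: iimg_largest; rewrite -[X in X >=[_] _]T1.
  by apply: wyler_join_geq; apply: iimg_geq.
by apply: iimg_largest; apply: geq_transl T2 _; apply: op_geq; apply: iimg_geq.
Qed.

Lemma wyler_dimgP (X Y : C) (f : hom X Y) (S : cluster W X) :
  dimg oe f (wyler_snd S) >= op (alpha w) (dimg os f (wyler_fst S)).
Proof. by rewrite alpha_dimg; apply: dimg_mono; case: (wyler_clusterP S). Qed.

(** The added [alpha] term makes saturation applicable. The join stays least, since an upper bound
    is itself a pair and so dominates this term. *)
Lemma wyler_joinP (X : C) (S T : cluster W X) :
  join oe (join oe (wyler_snd S) (wyler_snd T))
    (op (alpha w) (join os (wyler_fst S) (wyler_fst T))) >=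
  op (alpha w) (join os (wyler_fst S) (wyler_fst T)).
Proof. exact: join_ubr. Qed.

Definition wyler_orean : orean W.
Proof.
refine (@Orean C W (fun X => wyler_mk (wyler_botP X)) (fun X => wyler_mk (wyler_topP X))
  (fun X S T => wyler_sat (wyler_joinP S T))
  (fun X S T => wyler_mk (wyler_meetP S T)) _ _ _ _ _ _ _ _ _
  (fun X Y f S => wyler_sat (wyler_dimgP f S)) _ _
  (fun X Y f T => wyler_mk (wyler_iimgP f T)) _ _).
- by move=> X S; apply/wyler_geqP; split; apply: bot_least.
- by move=> X S; apply/wyler_geqP; split; apply: top_largest.
- move=> X S T; apply/wyler_geqP; split.
    exact: geq_transl (wyler_join_ge _ _ _) (join_ubl _ _ _).
  exact: geq_transl (join_ubl _ _ _) (join_ubl _ _ _).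
- move=> X S T; apply/wyler_geqP; split.
    exact: geq_transl (wyler_join_ge _ _ _) (join_ubr _ _ _).
  exact: geq_transl (join_ubl _ _ _) (join_ubr _ _ _).
- move=> X S T U /wyler_geqP [S1 S2] /wyler_geqP [T1 T2].
  have U1 : wyler_fst U >= join os (wyler_fst S) (wyler_fst T) by exact: join_lub.
  have [_ U2] := wyler_clusterP U.
  apply: wyler_sat_least => //; apply: join_lub; first exact: join_lub.
  by apply: geq_transl U2 _; apply: op_geq.
- by move=> X S T; apply/wyler_geqP; split; apply: meet_lbl.
- by move=> X S T; apply/wyler_geqP; split; apply: meet_lbr.
- by move=> X S T U /wyler_geqP [S1 S2] /wyler_geqP [T1 T2]; apply/wyler_geqP;
    split; apply: meet_glb.
- move=> X Y Z f g S T /wyler_geqP [/(geq_comp os) TS1 /(geq_comp oe) TS2].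
  (* The intermediate cluster for (O2) is the saturated direct image. *)
  exists (wyler_sat (wyler_dimgP f S)); split; first exact: wyler_sat_least.
  apply/wyler_geqP; split; last exact: dimg_geq.
  exact: geq_transl (wyler_join_ge _ _ _) (dimg_geq _ _ _).
- move=> X Y f S; apply/wyler_geqP; split; last exact: dimg_geq.
  exact: geq_transl (wyler_join_ge _ _ _) (dimg_geq _ _ _).
- by move=> X Y f S T /wyler_geqP [h1 h2]; apply: wyler_sat_least; apply: dimg_least.
- by move=> X Y f T; apply/wyler_geqP; split; apply: iimg_geq.
- by move=> X Y f S T /wyler_geqP [h1 h2]; apply/wyler_geqP; split;
    apply: iimg_largest.
Defined.

Let o : orean W := wyler_orean.

(** The left side unfolds to the Wyler join of [Im os f] with [Im oe f], and [Im oe f] is [alpha] of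
    [Im os f]. *)
Lemma wyler_fst_Im (X Y : C) (f : hom X Y) : wyler_fst (Im o f) = Im os f.
Proof.
rewrite [RHS]wyler_join_alpha (alpha_conormal w); reflexivity.
Qed.

Lemma wyler_snd_Im (X Y : C) (f : hom X Y) : wyler_snd (Im o f) = Im oe f.
Proof. by []. Qed.

Lemma wyler_fst_Ker (X Y : C) (f : hom X Y) : wyler_fst (Ker o f) = Ker os f.
Proof. by []. Qed.

Lemma wyler_snd_Ker (X Y : C) (f : hom X Y) : wyler_snd (Ker o f) = Ker oe f.
Proof. by []. Qed.

(** [n] after [emb w B] has trivial [Fe]-kernel, so it is, up to isomorphism, an embedding of its
    image. With [B'] the left side, [n] after [emb w B'] factors through it; cancelling [n] gives
    [B'] below [B]. *)
Lemma iimg_dimg_embedding (X Y : C) (A : cluster Fs Y) (n : hom X Y)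
    (B : cluster Fs X) :
  is_embedding os A n -> iimg os n (dimg os n B) = B.
Proof.
move=> qn; apply: geq_antisym; first by apply: iimg_largest; apply: dimg_geq.
have [Z [e [m [enb [qm qe]]]]] := of_factor w (n \o emb w B).
rewrite -/os -/oe in qm qe.
have Ke : Ker oe (n \o emb w B) = bot oe _.
  by rewrite Ker_comp (embedding_Ker_e qn) -(embedding_Ker_e (embP w B)).
rewrite Ke in qe; have [e' [e'e ee']] := quotient_bot_iso qe.
set B' := iimg os n _; have [<- _] := embP w B'; have [eB _] := embP w B.
have : Im os (n \o emb w B) >= Im os (n \o emb w B').
  rewrite !Im_comp (proj1 (embP w B')) eB; apply: dimg_least; exact: iimg_geq.
case/(proj2 qm) => g [eg _].
have -> : emb w B' = emb w B \o (e' \o g).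
  apply: (embedding_mono qn).
  by rewrite eg compA enb -compA (compA e) ee' comp1m.
rewrite Im_comp -[X in X >= _]eB; apply: dimg_mono; exact: top_largest.
Qed.

Lemma wyler_N1 : N1 o.
Proof.
move=> X Y f; split=> [S | T].
  have le : iimg o f (dimg o f S) >= join o S (Ker o f).
    apply: join_lub; first by apply: iimg_largest; apply: dimg_geq.
    by apply: iimg_mono; apply: bot_least.
  apply: geq_antisym => //; apply/wyler_geqP.
  (* In the second components (N1) for [oe] gives equality, so the first component of the join
     absorbs the Wyler join with the inverse image of [dimg oe f R]. *)
  have e2 : wyler_snd (join o S (Ker o f)) = wyler_snd (iimg o f (dimg o f S)).
    apply: geq_antisym; last by case/wyler_geqP: le.
    rewrite [X in _ >= X](proj1 (oe_N1 f)); exact: join_ubl.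
  split; last by rewrite e2; apply: geq_refl.
  have [<- _] := wyler_clusterP (join o S (Ker o f)); rewrite e2.
  set A := wyler_fst S; set R := wyler_snd S.
  apply: (@geq_transl _ _ _ _ _ _ (wyler_join w A (iimg oe f (dimg oe f R)))).
    apply: wyler_join_geq; last exact: geq_refl.
    by case/wyler_geqP: (join_ubl o S (Ker o f)).
  (* Factor [q \o f] as [n \o e]. Then [e] is a quotient of [iimg oe f (dimg oe f R)], while the
     embedding [n] does not affect saturation; so both sides are compared with the saturation of [A]
     along [e]. *)
  set q := quo w (dimg oe f R).
  have [Z [e [n [eqf [qn qe]]]]] := of_factor w (q \o f).
  rewrite Ker_comp Ker_quo -/oe in qe.
  have [g [eg _]] : exists! g, quo w (iimg oe f (dimg oe f R)) = g \o e.
    by apply: (proj2 qe); rewrite Ker_quo; apply: geq_refl.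
  rewrite [X in X >= _]/wyler_join eg; apply: geq_transl (iimg_dimg_comp _ _ _ _) _.
  have eA : iimg os f (wyler_join w (dimg os f A) (dimg oe f R)) =
      iimg os e (dimg os e A).
    rewrite /wyler_join -/q -iimg_comp -dimg_comp eqf iimg_comp dimg_comp.
    by rewrite (iimg_dimg_embedding _ qn).
  rewrite [X in _ >= X]eA; exact: geq_refl.
have [T1 T2] := wyler_clusterP (meet o T (Im o f)).
have Im1 : wyler_fst (meet o T (Im o f)) = meet os (wyler_fst T) (Im os f).
  by rewrite -wyler_fst_Im.
have Im2 : wyler_snd (meet o T (Im o f)) = meet oe (wyler_snd T) (Im oe f).
  by [].
have e2 : dimg oe f (iimg oe f (wyler_snd T)) = meet oe (wyler_snd T) (Im oe f).
  exact: (proj2 (oe_N1 f)).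
apply: wyler_ext; last exact: e2.
rewrite Im1 Im2 in T1 T2; rewrite Im1.
(* Condition (i) for the pair meeting [T] with the image of [f]; its inverse image along [f] is that
   of [T]. *)
have := proj2 wi X Y f _ _ T1 T2 (meet_lbr _ _ _) (meet_lbr _ _ _).
by rewrite iimg_meet iimg_Im meet_absorb -?e2 //; apply: top_largest.
Qed.

(** The second component follows: it lies above [alpha] of the first, hence above [Im oe f]. *)
Lemma wyler_conormalE (X Y : C) (f : hom X Y) (S : cluster W Y) :
  S >= Im o f <-> wyler_fst S >= Im os f.
Proof.
split=> [/wyler_geqP [h _] | h]; first by rewrite -wyler_fst_Im.
apply/wyler_geqP; rewrite wyler_fst_Im wyler_snd_Im -(alpha_conormal w).
by split=> //; apply: geq_transl (proj2 (wyler_clusterP S)) _; apply: op_geq.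
Qed.

(** The first component follows: being a Wyler join with the second, it lies above [beta] of the
    second, hence above [Ker os f]. *)
Lemma wyler_normalE (X Y : C) (f : hom X Y) (S : cluster W X) :
  S >= Ker o f <-> wyler_snd S >= Ker oe f.
Proof.
split=> [/wyler_geqP [_ h] // | h].
apply/wyler_geqP; rewrite wyler_fst_Ker wyler_snd_Ker -(beta_normal w).
split=> //; have [<- _] := wyler_clusterP S.
by apply: geq_transl (wyler_join_beta _ _ _) _; apply: op_geq.
Qed.

Lemma wyler_embedding (X Y Z : C) (f : hom X Y) (m : hom Z Y) :
  is_embedding os (Im os f) m -> is_embedding o (Im o f) m.
Proof.
case=> em um; split.
  by apply: geq_antisym; apply/wyler_conormalE; rewrite wyler_fst_Im em;
    apply: geq_refl.
by move=> V k /wyler_conormalE; rewrite wyler_fst_Im; apply: um.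
Qed.

Lemma wyler_quotient (X Y Z : C) (f : hom X Y) (q : hom X Z) :
  is_quotient oe (Ker oe f) q -> is_quotient o (Ker o f) q.
Proof.
case=> eq_ uq; split.
  by apply: geq_antisym; apply/wyler_normalE; rewrite wyler_snd_Ker eq_;
    apply: geq_refl.
by move=> V k /wyler_geqP [_ h]; apply: uq.
Qed.

Lemma wyler_N2 : N2 o.
Proof.
move=> X Y f; have [Z [e [m [ef [em ee]]]]] := of_factor w f.
exists Z, e, m; split=> //.
by split; [apply: wyler_embedding | apply: wyler_quotient].
Qed.

Lemma wyler_N3 : N3 o.
Proof.
move=> X S T; split=> -[Y [f ->]] [Z [g ->]].
  have [V [k ek]] := of_e_normal w (join oe (Ker oe f) (Ker oe g)).
  exists V, k; apply: geq_antisym.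
    apply/wyler_normalE; rewrite -ek; exact: join_ubl.
  by apply: join_lub; apply/wyler_normalE; rewrite wyler_snd_Ker -/oe -ek;
    (apply: join_ubl || apply: join_ubr).
(* Meets are componentwise, and [alpha] preserves them, so the second component also matches the
   image of [k]. *)
have [V [k ek]] := of_s_conormal w (meet os (Im os f) (Im os g)).
exists V, k; apply: wyler_ext.
  by rewrite wyler_fst_Im -/os -ek -!wyler_fst_Im.
by rewrite wyler_snd_Im -(alpha_conormal w) -/os -ek alpha_meet !(alpha_conormal w).
Qed.

Lemma wyler_incl_sP (X : C) (A : cluster Fs X) :
  wyler_join w A (op (alpha w) A) = A /\ op (alpha w) A >= op (alpha w) A.
Proof. by rewrite -wyler_join_alpha; split=> //; apply: geq_refl. Qed.

Lemma wyler_incl_eP (X : C) (R : cluster Fe X) :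
  wyler_join w (op (beta w) R) R = op (beta w) R /\ R >= op (alpha w) (op (beta w) R).
Proof. by split; [apply: wyler_join_beta_l | apply: alpha_beta]. Qed.

Lemma wyler_incl_s_geq (X Y : C) (f : hom X Y) (A : cluster Fs X) (B : cluster Fs Y) :
  B >=[f] A -> wyler_mk (wyler_incl_sP B) >=[f] wyler_mk (wyler_incl_sP A).
Proof. by move=> BA; apply/wyler_geqP; split; last exact: op_geq. Qed.

Lemma wyler_incl_e_geq (X Y : C) (f : hom X Y) (R : cluster Fe X) (Q : cluster Fe Y) :
  Q >=[f] R -> wyler_mk (wyler_incl_eP Q) >=[f] wyler_mk (wyler_incl_eP R).
Proof. by move=> QR; apply/wyler_geqP; split; first exact: op_geq. Qed.

Definition wyler_split : exact_split o os oe.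
Proof.
refine (@ExactSplit C W Fs Fe o os oe (wyler_fst_op w) (Operator wyler_incl_s_geq)
  (wyler_snd_op w) (Operator wyler_incl_e_geq) _ _ _ _ _ _ _) => //.
- move=> X S; apply: geq_antisym; last first.
    (* The first component of [S] is already in the left summand, the second in the right one. *)
    have /wyler_geqP [h _] := join_ubl o (wyler_mk (wyler_incl_sP (wyler_fst S)))
      (wyler_mk (wyler_incl_eP (wyler_snd S))).
    have /wyler_geqP [_ h'] := join_ubr o (wyler_mk (wyler_incl_sP (wyler_fst S)))
      (wyler_mk (wyler_incl_eP (wyler_snd S))).
    by apply/wyler_geqP.
  have [S1 S2] := wyler_clusterP S.
  apply: join_lub; apply/wyler_geqP; split => //; try exact: geq_refl.
  rewrite -[X in X >= _]S1; exact: wyler_join_beta.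
- by split=> X Y f; [apply: wyler_fst_Im | apply: wyler_fst_Ker].
- by move=> X Y f; apply: wyler_ext; rewrite ?wyler_fst_Im //; apply: alpha_conormal.
- by move=> X Y f; apply: wyler_ext => //; apply: beta_normal.
Defined.

End Sufficiency.

Theorem theorem161 (C : category) (Fs Fe : form C) :
  ((exists (G : form C) (o : orean G) (d : join_decomposition o),
      noetherian o /\ jd_exact d /\
      form_iso (jd_form_s d) Fs /\ form_iso (jd_form_e d) Fe) <->
   (exists w : orean_factorization Fs Fe, condition_i w /\ condition_ii w)) /\
  (forall (G : form C) (o : orean G) (d : join_decomposition o),
      noetherian o -> jd_exact d ->
      form_iso (jd_form_s d) Fs -> form_iso (jd_form_e d) Fe ->
      forall w : orean_factorization Fs Fe, form_iso G (wyler_form w)).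
Proof.
split; [split|].
- case=> G [o [d [o_noeth [d_exact [iso_s iso_e]]]]].
  have [u [v [uK vK]]] := iso_s; have [x [y [xK yK]]] := iso_e.
  pose os := orean_transport uK vK (jd_s_orean d).
  pose oe := orean_transport xK yK (jd_e_orean d).
  have [p] := exact_split_of_jd os oe d_exact iso_s iso_e.
  (* Its orean structures are transported from the fixed subforms. *)
  pose w := OreanFactorization
    (iso_conormal_form uK vK os (@jd_s_conormal _ _ _ d))
    (iso_normal_form xK yK oe (@jd_e_normal _ _ _ d))
    (fun X Y f => split_factor p f (proj1 (proj2 o_noeth))).
  exists w; split; first exact: (@split_condition_i _ _ _ _ _ w p).
  exact: (@split_condition_ii _ _ _ _ _ w p).
- case=> w [wi wii]; pose p := wyler_split wi wii.
  pose d := jd_of_split p (of_s_conormal w) (of_e_normal w).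
  exists (wyler_form w), (wyler_orean wi wii), d; split.
    by split; [apply: wyler_N1 | split; [apply: wyler_N2 | apply: wyler_N3]].
  split; first exact: jd_of_split_exact.
  by split; apply: form_iso_fixed; [apply: res_sK | apply: res_eK].
- move=> G o d o_noeth d_exact iso_s iso_e w.
  have [p] := exact_split_of_jd (of_s w) (of_e w) d_exact iso_s iso_e.
  exact: wyler_form_iso p o_noeth.
Qed.
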